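(* Let $\mathbb{F}$ be an infinite field. There exist a polynomial function $q$ and an absolute constant $c$ such that the following holds. Let $P(\mathbf{x},y)\in\mathbb{F}[x_1,\dots,x_n,y]$ be computed by an algebraic circuit $C$, and let $\varphi(\mathbf{x})\in\mathbb{F}[[x_1,\dots,x_n]]$ satisfy $\varphi(\mathbf{0})=0$, $P(\mathbf{x},\varphi(\mathbf{x}))=0$ and $\partial_yP(\mathbf{0},0)\neq 0$. Then for every $d\in\mathbb{N}$ there is an algebraic circuit $C'$ computing $\mathrm{Hom}_{\le d}[\varphi]$ with $\mathrm{size}(C')\le q(d,\mathrm{size}(C))$ and $\mathrm{depth}(C')\le \mathrm{depth}(C)+c$.
   Context: Algebraic circuits: directed acyclic graphs with leaves labelled by variables or field constants, internal gates $+$ and $\times$, and field constants on edges; size is the number of wires, depth the length of the longest output-to-leaf path. For a power series $\varphi$ in $\mathbf{x}$, $\mathrm{Hom}_{\le d}[\varphi]$ is the polynomial obtained by keeping exactly the monomials of total degree at most $d$ (the truncation of $\varphi$ at degree $d$). *)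

(* Defs.v *)
From mathcomp Require Import all_boot all_order all_algebra.
From mathcomp Require Export mpoly.
Set Implicit Arguments. Unset Strict Implicit. Unset Printing Implicit Defensive.
Import Order.TTheory GRing.Theory Num.Theory.
Local Open Scope ring_scope.

Section Defs.
Variable F : fieldType.

Definition pseries (n : nat) := 'X_{1..n} -> F.

Definition psmul n (f g : pseries n) : pseries n := fun m =>
  \sum_(m1 : 'X_{1..n < (mdeg m).+1} | (m1 <= m)%MM) f m1 * g (m - m1)%MM.

Definition psmono n (a : 'X_{1..n}) : pseries n := fun m => (m == a)%:R.

Fixpoint psexp n (f : pseries n) (k : nat) : pseries n :=
  if k is k'.+1 then psmul f (psexp f k') else psmono 0%MM.

Definition mnm_init n (m : 'X_{1..n.+1}) : 'X_{1..n} :=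
  [multinom m (widen_ord (leqnSn n) i) | i < n].

Definition ps_subst_last n (P : {mpoly F[n.+1]}) (phi : pseries n) : pseries n :=
  fun e => \sum_(m <- msupp P)
             P@_m * psmul (psmono (mnm_init m)) (psexp phi (m ord_max)) e.

Definition trunc_ps n (d : nat) (phi : pseries n) : {mpoly F[n]} :=
  \sum_(m : 'X_{1..n < d.+1}) phi m *: 'X_[m].

(* A circuit over variables x_0..x_{m-1} is a straight-line list of gates;
   gate k may only read gates j < k (this encodes a DAG). Internal gates
   carry their incoming wires as (source gate index, edge constant).
   The output is the last gate. *)
Inductive gate (m : nat) :=
| GVar of 'I_m
| GConst of F
| GAdd of seq (nat * F)
| GMul of seq (nat * F).

Definition circuit m := seq (gate m).

Definition gate_wires m (g : gate m) : seq (nat * F) :=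
  match g with GAdd ws | GMul ws => ws | _ => [::] end.

Definition circuit_wf m (C : circuit m) : Prop :=
  (0 < size C)%N /\
  forall k, (k < size C)%N ->
    all (fun w : nat * F => (w.1 < k)%N) (gate_wires (nth (GConst m 0) C k)).

Definition gate_val m (vals : seq {mpoly F[m]}) (g : gate m) : {mpoly F[m]} :=
  match g with
  | GVar i => 'X_i
  | GConst c => c%:MP
  | GAdd ws => \sum_(w <- ws) (w.2 *: nth 0 vals w.1)
  | GMul ws => \prod_(w <- ws) (w.2 *: nth 0 vals w.1)
  end.

Fixpoint circuit_vals_aux m (vals : seq {mpoly F[m]}) (C : circuit m) :=
  if C is g :: C' then circuit_vals_aux (rcons vals (gate_val vals g)) C'
  else vals.

Definition circuit_output m (C : circuit m) : {mpoly F[m]} :=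
  last 0 (circuit_vals_aux [::] C).

Definition computes m (C : circuit m) (p : {mpoly F[m]}) : Prop :=
  circuit_wf C /\ circuit_output C = p.

Definition circuit_size m (C : circuit m) : nat :=
  \sum_(g <- C) size (gate_wires g).

Definition gate_depth m (ds : seq nat) (g : gate m) : nat :=
  match g with
  | GAdd ws | GMul ws => (\max_(w <- ws) nth 0 ds w.1).+1
  | _ => 0%N
  end.

Fixpoint circuit_depths_aux m (ds : seq nat) (C : circuit m) :=
  if C is g :: C' then circuit_depths_aux (rcons ds (gate_depth ds g)) C'
  else ds.

Definition circuit_depth m (C : circuit m) : nat :=
  last 0%N (circuit_depths_aux [::] C).

End Defs.

Definition eval2 (q : {mpoly int[2]}) (a b : nat) : int :=
  q.@[fun i : 'I_2 => if val i == 0%N then a%:Z else b%:Z].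

(* Main.v *)
(* Furstenberg's formula: if [f] is the root through the origin of
   [p = P / alpha = y - F], where [alpha] is the derivative of [P] at the origin
   and [F] has only terms divisible by [x] or [y^2], then [f] is the residue of
   [y p' / p] in [y], that is [[y^N] (y p' * sum_i F^i y^(N-i))] up to degree [d]
   in [x] as soon as [N > 3 d].  The coefficients are extracted by interpolation,
   so only a bounded number of layers is added on top of circuits for [P]
   at points [(t x, e)].

   Interpolation needs polynomials of small degree, whereas the degree of [P] may
   be exponential in the size of its circuit, so [P] is first replaced by its
   truncation at degree [d].  Truncating does not add depth: with [lam] tracking
   the degree, every gate is represented by the values at many [lam] of a
   polynomial congruent to it modulo [lam^(d+1)].  At a sum gate the truncation
   (interpolate, cut, evaluate) is linear and merges with the sum.  A product gate
   is expanded into a product of powers of non-product gates, and is not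
   truncated; it suffices to keep the exponents small.  An exponent larger than
   [s^2] only occurs when at least three layers separate the two gates, and these
   leave room for a polynomial of degree [d] congruent to the power. *)
From HB Require Import structures.
Require Import Defs.
From mathcomp Require Import all_boot all_order all_algebra.
From mathcomp Require Import mpoly.
From mathcomp Require Import ring zify.
Set Implicit Arguments. Unset Strict Implicit. Unset Printing Implicit Defensive.
Import GRing.Theory.
Local Open Scope ring_scope.

(** * The residue formula *)

(** Every term of the binomial expansion carries [u ^+ m] or [v ^+ n]. The double induction splits
    off one factor and treats its two summands by the two hypotheses. *)
Lemma expr_ideal (R : comNzRingType) (u v a b : R) (m n : nat) :
  exists x y, (u * a + v * b) ^+ (m + n) = u ^+ m * x + v ^+ n * y.
Proof.
elim: m n => [|m IHm] n.
  by exists ((u * a + v * b) ^+ n), 0; rewrite add0n; ring.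
elim: n => [|n [x' [y' IHn]]].
  by exists 0, ((u * a + v * b) ^+ m.+1); rewrite addn0; ring.
have [x [y Hxy]] := IHm n.+1.
exists (a * x + v * b * x'), (u * a * y + b * y').
rewrite addSn exprS mulrDl {1}Hxy -addSnnS IHn !exprS; ring.
Qed.

Lemma poly_coef0_divX (B : comNzRingType) (p : {poly B}) : p`_0 = 0 -> exists r, p = r * 'X.
Proof.
move=> p0; have : root p 0 by rewrite /root horner_coef0 p0.
by move=> /factor_theorem [r ->]; exists r; rewrite subr0.
Qed.

Section Residue.
Variable A : comNzRingType.
Local Notation R := {poly {poly A}}.
Local Notation lam := (('X : {poly A})%:P : R).

Lemma coef2_lamXn (r : R) d i j : (j <= d)%N -> (r * lam ^+ d.+1)`_i`_j = 0.
Proof. by move=> le_jd; rewrite -polyC_exp coefMC coefMXn ltnS le_jd. Qed.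

(* This is Furstenberg's diagonal formula: the geometric sum is a truncation of
   [y^(N+1) / p], because [y - p] lies in the ideal [(lam, y^2)], so the
   coefficient extracted is the residue of [y p' / p] at the simple root [f]. *)
Lemma residue_formula (d : nat) (p q : R) (f r : {poly A}) (a b : R) :
    (0 < d)%N ->
    p = q * ('X - f%:P) + (r * 'X^(d.+1))%:P ->
    f`_0 = 0 -> q`_0`_0 = 1 -> 'X - p = 'X^2 * a + lam * b ->
  forall j, (j <= d)%N ->
    ('X * p^`() * \sum_(i < (3 * d).+2)
       'X ^+ ((3 * d).+1 - i) * ('X - p) ^+ i)`_(3 * d).+1`_j = f`_j.
Proof.
move=> d0 pE f0 q0 Fab j le_jd.
set F := 'X - p; set N := (3 * d).+1; set K := \sum_(i < N.+1) _.
have pK : p * K = 'X^(N.+1) - F ^+ N.+1.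
  by rewrite subrXX; congr (_ * _); rewrite /F; ring.
have [f' fE] := poly_coef0_divX f0.
have rlam : (r * 'X^(d.+1))%:P = r%:P * lam ^+ d.+1 :> R by rewrite polyCM polyC_exp.
have flam : f%:P = f'%:P * lam :> R by rewrite fE polyCM.
(* Here [N.+1 = 3d + 2] splits as [(2d + 1) + (d + 1)]: modulo [lam^(d+1)], at least [2d + 1]
   factors [y^2] remain, hence [y^(4d+2)]. *)
have [x1 [y1 FN]] : exists x y, F ^+ N.+1 = 'X^(4 * d + 2) * x + lam ^+ d.+1 * y.
  have [x [y Hxy]] := expr_ideal 'X^2 lam a b (2 * d).+1 d.+1.
  exists x, y; have -> : N.+1 = ((2 * d).+1 + d.+1)%N by rewrite /N; lia.
  by rewrite /F Fab Hxy -exprM; congr ('X ^+ _ * _ + _); lia.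
have [q1 qE] : exists q1 : R, exists q2 : {poly A}, q = 1 + q1 * 'X + (q2 * 'X)%:P.
  have [q1 q1E] : exists q1, q - (q`_0)%:P = q1 * 'X.
    by apply: poly_coef0_divX; rewrite coefB coefC eqxx subrr.
  have [q2 q2E] : exists q2, q`_0 - 1 = q2 * 'X.
    by apply: poly_coef0_divX; rewrite coefB coef1 q0 subrr.
  by exists q1, q2; rewrite -q1E -q2E polyCB polyC1; ring.
have {qE} [q2 qE] := qE.
set X := ('X - f%:P) * K.
have qX : q * X = 'X^(N.+1) - F ^+ N.+1 - lam ^+ d.+1 * (r%:P * K).
  by rewrite -pK pE rlam /X; ring.
have dp : p^`() = q + q^`() * ('X - f%:P).
  by rewrite pE derivD derivM derivB derivX !derivC subr0 addr0; ring.
(* By the product rule only [y q K] matters: the term with the derivative of [q] lies in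
   [(y^(N+1), lam^(d+1))], beyond the coefficient of [y^N lam^j]. *)
have -> : 'X * p^`() * K = 'X * (q * K) + q^`() * X * 'X.
  by rewrite dp /X; ring.
(* [q] is a unit modulo [(y^N+1, lam^d+1)], so [X] lies in that ideal as [q X] does. *)
have [x2 [y2 XE]] : exists x y, X = 'X^(N.+1) * x + lam ^+ d.+1 * y.
  have [x [y Hk]] := expr_ideal 'X lam (- q1) (- q2%:P) N.+1 d.+1.
  have q1q : 'X * - q1 + lam * - q2%:P = 1 - q by rewrite qE polyCM; ring.
  rewrite q1q in Hk.
  have qX' : q * X = 'X^(N.+1) * (1 - 'X^(4 * d + 2 - N.+1) * x1)
                     + lam ^+ d.+1 * (- (y1 + r%:P * K)).
    rewrite qX FN; have -> : (4 * d + 2 = N.+1 + (4 * d + 2 - N.+1))%N by rewrite /N; lia.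
    rewrite exprD addKn; ring.
  (* Iterating [X = (1 - q) X + q X] replaces [X] by [(1 - q)^k X] modulo the ideal. As [1 - q] lies
     in [(y, lam)], a high power of it lies in the ideal. *)
  have Xk k : exists x y, X = (1 - q) ^+ k * X + 'X^(N.+1) * x + lam ^+ d.+1 * y.
    elim: k => [|k [x' [y' IH]]]; first by exists 0, 0; ring.
    eexists; eexists.
    rewrite {1}IH (_ : (1 - q) ^+ k * X = (1 - q) ^+ k.+1 * X + (1 - q) ^+ k * (q * X)).
      rewrite qX'.
      instantiate (2 := x' + (1 - q) ^+ k * (1 - 'X^(4 * d + 2 - N.+1) * x1)).
      instantiate (1 := y' + (1 - q) ^+ k * (- (y1 + r%:P * K))).
      set u := 'X^_; set v := lam ^+ _; ring.
    rewrite exprS; ring.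
  have [x' [y' ->]] := Xk (N.+1 + d.+1)%N; rewrite Hk.
  exists (x * X + x'), (y * X + y'); set u := 'X^_; set v := lam ^+ _; ring.
rewrite coefD coefD (_ : q^`() * X * 'X = 'X * q^`() * x2 * 'X^(N.+1) + 'X * q^`() * y2 * lam ^+ d.+1); last first.
  by rewrite XE; set u := 'X^_; set v := lam ^+ _; ring.
rewrite [X in _ + X](_ : _ = 0) ?addr0; last first.
  by rewrite coefD coefD coefMXn ltnSn coef0 coef2_lamXn // addr0.
(* [W] is the geometric series of [y^(d+1) / (y - f)], exact up to [f^(d+1)], a multiple of
   [lam^(d+1)]. Multiplying by [y^(d+1)] thus replaces dividing [q X] by [y - f]. *)
set W : R := \sum_(i < d.+1) 'X ^+ (d - i) * f%:P ^+ i.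
have WE : ('X - f%:P) * W = 'X^(d.+1) - f%:P ^+ d.+1 by rewrite subrXX.
have key : 'X * (q * K) * 'X^(d.+1) = 'X * W * 'X^(N.+1) - 'X * W * x1 * 'X^(4 * d + 2)
     + 'X * (f'%:P ^+ d.+1 * q * K - W * (y1 + r%:P * K)) * lam ^+ d.+1.
  have -> : 'X^(d.+1) = ('X - f%:P) * W + f'%:P ^+ d.+1 * lam ^+ d.+1.
    by rewrite WE flam exprMn subrK.
  have -> : 'X * (q * K) * (('X - f%:P) * W + f'%:P ^+ d.+1 * lam ^+ d.+1)
     = 'X * W * (q * X) + 'X * (q * K) * (f'%:P ^+ d.+1 * lam ^+ d.+1) by rewrite /X; ring.
  rewrite qX FN; set u := 'X^_; set v := lam ^+ _; set w := f'%:P ^+ _; ring.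
(* The shift moves coefficient [N] to [N + d + 1 = 4d + 2]; the [x1] term has one more factor [y]
   than that and drops out. *)
have := congr1 (fun g : R => g`_(N + d.+1)`_j) key.
rewrite coefMXn ltnNge leq_addl /= addnK => ->.
rewrite !coefD coef2_lamXn // addr0 !coefN.
rewrite (_ : 'X * W * x1 = W * x1 * 'X); last by ring.
have N4 : (N + d.+1)%N = (4 * d + 2)%N by rewrite /N; lia.
rewrite (_ : (W * x1 * 'X * 'X^(4 * d + 2))`_(N + d.+1) = 0) ?coef0 ?subr0; last first.
  by rewrite N4 coefMXn ltnn subnn coefMX.
rewrite coefMXn ltnNge addnS ltnS leq_addr /= subSS addnC addnK coefXM gtn_eqF //.
(* In [W] the power [y^(d-1)] occurs only for [i = 1], with coefficient [f]. *)
rewrite /W coef_sum (bigD1 (inord 1)) //= big1 ?addr0 => [|i].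
  by rewrite -polyC_exp coefMC coefXn inordK // subn1 eqxx mul1r.
rewrite -val_eqE /= inordK // => i1; rewrite -polyC_exp coefMC coefXn.
rewrite (_ : (d.-1 == d - i)%N = false) ?mul0r //; apply/eqP; have := ltn_ord i.
by move: i1 => /eqP; lia.
Qed.
End Residue.

(** * Interpolation *)

Lemma infinite_uniq_seq (T : eqType) (T_infinite : forall s : seq T, exists x, x \notin s) (l : nat) :
  exists2 s : seq T, uniq s & size s = l.
Proof.
elim: l => [|l [s us <-]]; first by exists [::].
by have [x xs] := T_infinite s; exists (x :: s) => //=; rewrite xs.
Qed.

Section Interpolation.
Variable F : fieldType.

Definition lagrange_basis (L : seq F) (t : F) : {poly F} :=
  \prod_(u <- L | u != t) ((t - u)^-1 *: ('X - u%:P)).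

Lemma horner_lagrange_basis L t v : v \in L -> (lagrange_basis L t).[v] = (v == t)%:R.
Proof.
move=> vL; rewrite horner_prod; have [->|vt] := eqVneq v t.
  rewrite big1 // => u ut.
  by rewrite hornerZ hornerXsubC mulVf // subr_eq0 eq_sym.
by rewrite (big_rem v vL) /= vt hornerZ hornerXsubC subrr mulr0 mul0r.
Qed.

Lemma size_lagrange_basis L t : t \in L -> (size (lagrange_basis L t) <= size L)%N.
Proof.
move=> tL; have sz s : (size (\prod_(u <- s | u != t) ((t - u)^-1 *: ('X - u%:P)))%R
    <= (count (fun u => u != t) s).+1)%N.
  elim: s => [|u s IHs]; first by rewrite big_nil size_poly1.
  rewrite big_cons /=; case: eqP => _ //=.
  rewrite -scalerAl; apply: leq_trans (size_scale_leq _ _) _.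
  apply: leq_trans (size_polyMleq _ _) _.
  by rewrite size_XsubC add2n.
apply: leq_trans (sz L) _; rewrite -(count_predC (fun u => u != t) L) -addn1 leq_add2l.
by rewrite -has_count; apply/hasP; exists t => //=; rewrite eqxx.
Qed.

(** Nodes and weights are scalars even though [p] has coefficients in [B], so a coefficient costs a
    single sum gate over values of [p]. Both sides come from polynomials that agree at more points
    than their degree. *)
Lemma interpolation (B : idomainType) (iota : {rmorphism F -> B}) (L : seq F) (p : {poly B}) i :
  uniq L -> (size p <= size L)%N ->
  p`_i = \sum_(t <- L) iota (lagrange_basis L t)`_i * p.[iota t].
Proof.
move=> uL sp.
pose r := \sum_(t <- L) p.[iota t] *: map_poly iota (lagrange_basis L t).
suff {1}-> : p = r.
  by rewrite coef_sum; apply: eq_bigr => t _; rewrite coefZ coef_map mulrC.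
apply/eqP; rewrite -subr_eq0; apply/eqP.
apply: (@roots_geq_poly_eq0 _ _ (map iota L)).
- apply/allP => _ /mapP[u uL' ->]; rewrite /root hornerD hornerN subr_eq0.
  rewrite horner_sum (bigD1_seq u) //= big1 ?addr0 => [|t tu].
    by rewrite hornerZ horner_map horner_lagrange_basis // eqxx rmorph1 mulr1.
  by rewrite hornerZ horner_map horner_lagrange_basis // eq_sym (negPf tu) rmorph0 mulr0.
- by rewrite map_inj_uniq //; apply: fmorph_inj.
rewrite size_map; apply: leq_trans (size_polyD _ _) _.
rewrite geq_max sp size_polyN /r big_seq.
elim/big_ind: _ => [|x y xs ys|t tL]; first by rewrite size_poly0.
  by apply: leq_trans (size_polyD _ _) _; rewrite geq_max; apply/andP; split.
apply: leq_trans (size_scale_leq _ _) _.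
by rewrite size_map_poly; apply: size_lagrange_basis.
Qed.
End Interpolation.

(** * Degree bounds in two variables *)

Section Bidegree.
Variable A : comNzRingType.
Implicit Types p q : {poly {poly A}}.

(** The two degrees are bounded separately, as interpolation on a product grid requires. *)
Definition bideg_le k p := forall i j, (k < i)%N || (k < j)%N -> p`_i`_j = 0.

Lemma bideg_le_size k p : bideg_le k p -> (size p <= k.+1)%N.
Proof.
move=> pk; apply/leq_sizeP => i ki; apply/polyP => j.
by rewrite pk ?ki // coef0.
Qed.

Lemma bideg_le_size2 k p i : bideg_le k p -> (size (p`_i)%R <= k.+1)%N.
Proof. by move=> pk; apply/leq_sizeP => j kj; rewrite pk // kj orbT. Qed.

Lemma bideg_leW k l p : (k <= l)%N -> bideg_le k p -> bideg_le l p.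
Proof.
by move=> kl pk i j /orP[] lt; apply: pk; rewrite (leq_ltn_trans kl lt) ?orbT.
Qed.

Lemma bideg_leD k p q : bideg_le k p -> bideg_le k q -> bideg_le k (p + q).
Proof. by move=> pk qk i j h; rewrite !coefD pk // qk // addr0. Qed.

Lemma bideg_leN k p : bideg_le k p -> bideg_le k (- p).
Proof. by move=> pk i j h; rewrite !coefN pk // oppr0. Qed.

Lemma bideg_le0 k : bideg_le k 0.
Proof. by move=> i j _; rewrite !coef0. Qed.

Lemma bideg_leC k (a : A) : bideg_le k a%:P%:P.
Proof.
by move=> i j h; rewrite coefC; case: i h => [|i] h; rewrite ?coef0 //= coefC; case: j h.
Qed.

Lemma bideg_leM k l p q : bideg_le k p -> bideg_le l q -> bideg_le (k + l) (p * q).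
Proof.
move=> pk ql i j h; rewrite coefM coef_sum big1 // => -[i1 /= i1i] _.
rewrite coefM big1 // => -[j1 /= j1j] _.
have [/orP h1|] := boolP ((k < i1) || (k < j1))%N.
  by rewrite pk ?mul0r //; apply/orP.
rewrite negb_or -!leqNgt => /andP[a b]; rewrite (ql _ (j - j1)%N) ?mulr0 //.
by case/orP: h => c; apply/orP; [left|right]; lia.
Qed.

Lemma bideg_le_sum k (I : Type) (r : seq I) (P : pred I) (f : I -> {poly {poly A}}) :
  (forall i, P i -> bideg_le k (f i)) -> bideg_le k (\sum_(i <- r | P i) f i).
Proof.
move=> fk; apply: (big_ind (bideg_le k)) => //; [exact: bideg_le0|].
by move=> p q; apply: bideg_leD.
Qed.

Lemma bideg_leX k p n : bideg_le k p -> bideg_le (n * k) (p ^+ n).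
Proof.
move=> pk; elim: n => [|n IHn]; first by rewrite expr0 -!polyC1; apply: bideg_leC.
by rewrite exprS mulSn; apply: bideg_leM.
Qed.

Lemma bideg_le_var : bideg_le 1 ('X : {poly {poly A}}).
Proof. by move=> i j; rewrite coefX; case: i => [|[|i]]; case: j => [|[|j]] //=; rewrite ?coef0 // coef1. Qed.

Lemma bideg_le_lam : bideg_le 1 ('X%:P : {poly {poly A}}).
Proof. by move=> i j; rewrite coefC; case: i => [|[|i]]; case: j => [|[|j]] //=; rewrite ?coef0 // coefX. Qed.

Lemma bideg_le_deriv k p : bideg_le k p -> bideg_le k p^`().
Proof.
move=> pk i j h; rewrite coef_deriv coefMn pk ?mul0rn //.
by case/orP: h => [/leqW ->|->]; rewrite ?orbT.
Qed.

End Bidegree.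

(** * Building circuits *)

Section Circuits.
Variables (F : fieldType) (n : nat).
Implicit Types (C : circuit F n) (p : {mpoly F[n]}).

Definition vals C := circuit_vals_aux [::] C.
Definition depths C := circuit_depths_aux [::] C.
(** Unlike [circuit_wf], this admits the empty circuit, from which constructions start. *)
Definition wires_wf C := forall k, (k < size C)%N ->
  all (fun w : nat * F => (w.1 < k)%N) (gate_wires (nth (GConst n 0) C k)).

Lemma vals_rcons C g : vals (rcons C g) = rcons (vals C) (gate_val (vals C) g).
Proof. by rewrite /vals; elim: C [::] => //= h C IHC vs; rewrite IHC. Qed.

Lemma depths_rcons C g : depths (rcons C g) = rcons (depths C) (gate_depth (depths C) g).
Proof. by rewrite /depths; elim: C [::] => //= h C IHC vs; rewrite IHC. Qed.

Lemma size_vals C : size (vals C) = size C.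
Proof. by elim/last_ind: C => // C g IHC; rewrite vals_rcons !size_rcons IHC. Qed.

Lemma size_depths C : size (depths C) = size C.
Proof. by elim/last_ind: C => // C g IHC; rewrite depths_rcons !size_rcons IHC. Qed.

Lemma nth_vals_cat C E k : (k < size C)%N -> nth 0 (vals (C ++ E)) k = nth 0 (vals C) k.
Proof.
move=> kC; elim/last_ind: E => [|E g IHE]; first by rewrite cats0.
by rewrite -rcons_cat vals_rcons nth_rcons size_vals size_cat ltn_addr.
Qed.

Lemma nth_depths_cat C E k : (k < size C)%N -> nth 0%N (depths (C ++ E)) k = nth 0%N (depths C) k.
Proof.
move=> kC; elim/last_ind: E => [|E g IHE]; first by rewrite cats0.
by rewrite -rcons_cat depths_rcons nth_rcons size_depths size_cat ltn_addr.
Qed.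

Lemma gate_val_eq (vs vs' : seq {mpoly F[n]}) g :
  (forall w, w \in gate_wires g -> nth 0 vs w.1 = nth 0 vs' w.1) -> gate_val vs g = gate_val vs' g.
Proof. by case: g => //= ws eqw; apply: eq_big_seq => w /eqw ->. Qed.

Lemma gate_depth_eq (ds ds' : seq nat) (g : gate F n) :
  (forall w, w \in gate_wires g -> nth 0%N ds w.1 = nth 0%N ds' w.1) -> gate_depth ds g = gate_depth ds' g.
Proof. by case: g => //= ws eqw; congr _.+1; apply: eq_big_seq => w /eqw ->. Qed.

Lemma wires_wfP C k w : wires_wf C -> (k < size C)%N ->
  w \in gate_wires (nth (GConst n 0) C k) -> (w.1 < k)%N.
Proof. by move=> wfC kC; apply/allP: w; apply: wfC. Qed.

Lemma split_circuit C k : (k < size C)%N ->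
  C = rcons (take k C) (nth (GConst n 0) C k) ++ drop k.+1 C.
Proof. by move=> kC; rewrite -take_nth // cat_take_drop. Qed.

Lemma nth_vals C k : wires_wf C -> (k < size C)%N ->
  nth 0 (vals C) k = gate_val (vals C) (nth (GConst n 0) C k).
Proof.
move=> wfC kC; have szk : size (take k C) = k by rewrite size_takel // ltnW.
rewrite {1}(split_circuit kC) nth_vals_cat ?size_rcons ?szk //.
rewrite vals_rcons nth_rcons size_vals szk ltnn eqxx.
apply: gate_val_eq => w /(wires_wfP wfC kC) wk.
by rewrite -{2}(cat_take_drop k C) nth_vals_cat // szk.
Qed.

Lemma nth_depths C k : wires_wf C -> (k < size C)%N ->
  nth 0%N (depths C) k = gate_depth (depths C) (nth (GConst n 0) C k).
Proof.
move=> wfC kC; have szk : size (take k C) = k by rewrite size_takel // ltnW.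
rewrite {1}(split_circuit kC) nth_depths_cat ?size_rcons ?szk //.
rewrite depths_rcons nth_rcons size_depths szk ltnn eqxx.
apply: gate_depth_eq => w /(wires_wfP wfC kC) wk.
by rewrite -{2}(cat_take_drop k C) nth_depths_cat // szk.
Qed.

Lemma wires_wf_rcons C g : wires_wf C ->
  all (fun w : nat * F => (w.1 < size C)%N) (gate_wires g) -> wires_wf (rcons C g).
Proof.
move=> wfC wg k; rewrite size_rcons ltnS leq_eqVlt nth_rcons => /orP[/eqP ->|kC].
  by rewrite ltnn eqxx.
by rewrite kC; apply: wfC.
Qed.

Lemma circuit_size_rcons C g : circuit_size (rcons C g) = (circuit_size C + size (gate_wires g))%N.
Proof. by rewrite /circuit_size -cats1 big_cat big_seq1. Qed.

(* Wires carry constants, so a scalar multiple of a gate is as good as a gate. *)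
Definition available C p (e : nat) := exists (k : nat) (c : F),
  [/\ (k < size C)%N, p = c *: nth 0 (vals C) k & (nth 0%N (depths C) k <= e)%N].

Definition extends C C' := exists2 E, C' = C ++ E & wires_wf C'.

Lemma extends_refl C : wires_wf C -> extends C C.
Proof. by exists [::]; rewrite ?cats0. Qed.

Lemma extends_wf C C' : extends C C' -> wires_wf C'.
Proof. by case. Qed.

Lemma extends_trans C C' C'' : extends C C' -> extends C' C'' -> extends C C''.
Proof. by move=> [E -> _] [E' -> wf]; exists (E ++ E'); rewrite ?catA. Qed.

Lemma extends_rcons C g : wires_wf C ->
  all (fun w : nat * F => (w.1 < size C)%N) (gate_wires g) -> extends C (rcons C g).
Proof. by move=> wfC wg; exists [:: g]; rewrite ?cats1 //; apply: wires_wf_rcons. Qed.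

Lemma available_extends C C' p e : extends C C' -> available C p e -> available C' p e.
Proof.
move=> [E -> _] [k [c [kC -> de]]]; exists k, c; split.
- by rewrite size_cat ltn_addr.
- by rewrite nth_vals_cat.
- by rewrite nth_depths_cat.
Qed.

Lemma availableW C p e e' : (e <= e')%N -> available C p e -> available C p e'.
Proof. by move=> ee [k [c [kC -> de]]]; exists k, c; split=> //; apply: leq_trans ee. Qed.

Lemma availableZ C a p e : available C p e -> available C (a *: p) e.
Proof. by move=> [k [c [kC -> de]]]; exists k, (a * c); rewrite scalerA. Qed.

Lemma available_rcons C g : available (rcons C g) (gate_val (vals C) g) (gate_depth (depths C) g).
Proof.
exists (size C), 1; rewrite size_rcons ltnSn scale1r vals_rcons depths_rcons; split=> //.
  by rewrite nth_rcons size_vals ltnn eqxx.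
by rewrite nth_rcons size_depths ltnn eqxx.
Qed.

(** Quantifying over all extensions of [C] lets separate constructions be chained with their costs
    added. Only new wires are counted, so leaves are free. *)
Definition obtainable C p (e cost : nat) := forall C', extends C C' ->
  exists C'', [/\ extends C' C'', available C'' p e & (circuit_size C'' <= circuit_size C' + cost)%N].

Lemma available_obtainable C p e : available C p e -> obtainable C p e 0.
Proof.
move=> av C' CC'; exists C'; split; last by rewrite addn0.
  exact/extends_refl/(extends_wf CC').
exact: available_extends av.
Qed.

Lemma obtainableW C p e e' k k' : (e <= e')%N -> (k <= k')%N -> obtainable C p e k -> obtainable C p e' k'.
Proof.
move=> ee kk ob C' /ob[C'' [CC'' av le]]; exists C''; split=> //; first exact: availableW av.
by apply: leq_trans le _; rewrite leq_add2l.
Qed.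

Lemma obtainableZ C a p e k : obtainable C p e k -> obtainable C (a *: p) e k.
Proof. by move=> ob C' /ob[C'' [CC'' av le]]; exists C''; split=> //; apply: availableZ. Qed.

Lemma obtainable_gate C g : gate_wires g = [::] -> obtainable C (gate_val [::] g) (gate_depth [::] g) 0.
Proof.
move=> g0 C' CC'; exists (rcons C' g); split.
- by apply: extends_rcons; [exact: extends_wf CC'|rewrite g0].
- rewrite (@gate_val_eq _ (vals C')) ?(@gate_depth_eq _ (depths C')) ?g0 //; exact: available_rcons.
- by rewrite circuit_size_rcons g0 addn0.
Qed.

Lemma obtainable_const C c e : obtainable C c%:MP e 0.
Proof. exact: (obtainableW (leq0n e) (leqnn 0) (@obtainable_gate C (GConst n c) erefl)). Qed.

Lemma obtainable_var C i e : obtainable C 'X_i e 0.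
Proof. exact: (obtainableW (leq0n e) (leqnn 0) (@obtainable_gate C (GVar F i) erefl)). Qed.

Lemma obtain_all C (I : eqType) (r : seq I) (f : I -> {mpoly F[n]}) e k :
  (forall i, i \in r -> obtainable C (f i) e k) -> forall C', extends C C' ->
  exists C'', [/\ extends C' C'', forall i, i \in r -> available C'' (f i) e
                & (circuit_size C'' <= circuit_size C' + size r * k)%N].
Proof.
elim: r => [|i r IHr] ob C' CC'.
  by exists C'; split=> //; [exact/extends_refl/(extends_wf CC')|rewrite addn0].
have [C1 [C1C av1 le1]] := ob i (mem_head _ _) _ CC'.
have [|C2 [C2C av2 le2]] := IHr _ _ (extends_trans CC' C1C).
  by move=> j jr; apply: ob; rewrite inE jr orbT.
exists C2; split; first exact: extends_trans C2C.
  move=> j; rewrite inE => /orP[/eqP ->|]; last exact: av2.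
  exact: available_extends av1.
by apply: leq_trans le2 _; rewrite /= mulSn addnA leq_add2r.
Qed.

Lemma obtain_wires C (I : eqType) (r : seq I) (f : I -> {mpoly F[n]}) e k :
  (forall i, i \in r -> obtainable C (f i) e k) -> forall C', extends C C' ->
  exists C'' (ws : seq (nat * F)),
    [/\ extends C' C'', all (fun w => (w.1 < size C'')%N) ws,
        [seq f i | i <- r] = [seq w.2 *: nth 0 (vals C'') w.1 | w <- ws],
        (\max_(w <- ws) nth 0%N (depths C'') w.1 <= e)%N
      & (circuit_size C'' <= circuit_size C' + size r * k)%N].
Proof.
move=> ob C' CC'; have [C'' [C'C'' av le]] := obtain_all ob CC'.
suff [ws [? ? ?]] : exists ws : seq (nat * F), [/\ all (fun w => (w.1 < size C'')%N) ws,
    [seq f i | i <- r] = [seq w.2 *: nth 0 (vals C'') w.1 | w <- ws]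
    & (\max_(w <- ws) nth 0%N (depths C'') w.1 <= e)%N] by exists C'', ws.
elim: r av {ob le} => [|i r IHr] av; first by exists [::]; rewrite big_nil.
have [|ws [w1 w2 w3]] := IHr; first by move=> j jr; apply: av; rewrite inE jr orbT.
have [j [c [jC fi de]]] := av i (mem_head _ _).
by exists ((j, c) :: ws); rewrite /= jC w1 fi w2 big_cons geq_max de.
Qed.

Lemma obtainable_sum C (I : eqType) (r : seq I) (f : I -> {mpoly F[n]}) e k :
  (forall i, i \in r -> obtainable C (f i) e k) ->
  obtainable C (\sum_(i <- r) f i) e.+1 (size r * k.+1).
Proof.
move=> ob C' CC'; have [C'' [ws [C'C'' ww fE de le]]] := obtain_wires ob CC'.
exists (rcons C'' (GAdd _ ws)); have wf'' := extends_wf C'C''; split.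
- exact/(extends_trans C'C'')/extends_rcons.
- rewrite -(big_map f xpredT id) fE big_map.
  by apply: availableW (available_rcons _ _).
have szws : size ws = size r by move/(congr1 size): fE; rewrite !size_map.
by rewrite circuit_size_rcons /= szws mulnS; move: le; lia.
Qed.

Lemma obtainable_prod C (I : eqType) (r : seq I) (f : I -> {mpoly F[n]}) e k :
  (forall i, i \in r -> obtainable C (f i) e k) ->
  obtainable C (\prod_(i <- r) f i) e.+1 (size r * k.+1).
Proof.
move=> ob C' CC'; have [C'' [ws [C'C'' ww fE de le]]] := obtain_wires ob CC'.
exists (rcons C'' (GMul _ ws)); have wf'' := extends_wf C'C''; split.
- exact/(extends_trans C'C'')/extends_rcons.
- rewrite -(big_map f xpredT id) fE big_map.
  by apply: availableW (available_rcons _ _).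
have szws : size ws = size r by move/(congr1 size): fE; rewrite !size_map.
by rewrite circuit_size_rcons /= szws mulnS; move: le; lia.
Qed.

Lemma obtainable_computes p e k : obtainable [::] p e k ->
  exists C, [/\ computes C p, (circuit_size C <= k.+1)%N & (circuit_depth C <= e.+1)%N].
Proof.
have ext0 : extends [::] [::] by apply: extends_refl => k0; rewrite ltn0.
move=> ob.
have [|C' [ws [CC' ww fE de le]]] := @obtain_wires [::] _ [:: p] id e k _ _ ext0.
  by move=> _ /predU1P[->|//].
(* A last sum gate with one wire makes the value the output and absorbs the scalar allowed by
   [available], for one wire and one layer. *)
exists (rcons C' (GAdd _ ws)); have wf' := extends_wf CC'.
have szws : size ws = 1%N by move/(congr1 size): fE; rewrite !size_map.
split; last by rewrite /circuit_depth -/(depths _) depths_rcons last_rcons.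
  split; first by split; [rewrite size_rcons|exact: wires_wf_rcons].
  by rewrite /circuit_output -/(vals _) vals_rcons last_rcons /= -(big_map _ xpredT id) -fE big_seq1.
by rewrite circuit_size_rcons /= szws addn1 ltnS (leq_trans le) // /circuit_size big_nil add0n mul1n.
Qed.

End Circuits.

(** * Power series and graded substitutions *)

Section PowerSeries.
Variables (F : fieldType) (n d : nat).
Implicit Types (p q : {mpoly F[n]}) (f g : pseries F n).

Definition agree_upto p f := forall m : 'X_{1..n}, (mdeg m <= d)%N -> p@_m = f m.

Lemma agree_trunc_ps f : agree_upto (trunc_ps d f) f.
Proof. by move=> m md; rewrite /trunc_ps mcoeff_mpoly. Qed.

Lemma agree_psmono m : agree_upto 'X_[m] (psmono F m).
Proof. by move=> m' _; rewrite mcoeffX /psmono eq_sym. Qed.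

Lemma agree_psmul p q f g : agree_upto p f -> agree_upto q g -> agree_upto (p * q) (psmul f g).
Proof.
move=> pf qg m md; rewrite (mcoeff_poly_mul_lin _ _ (ltnSn _)) /psmul.
apply: eq_bigr => m1 /mnm_lepP m1m; rewrite pf ?qg //.
  exact: leq_trans (mdegB _ _) md.
by apply: leq_trans md; rewrite [leqLHS]mdegE [leqRHS]mdegE; apply: leq_sum => i _; apply: m1m.
Qed.

Lemma agree_psexp p f k : agree_upto p f -> agree_upto (p ^+ k) (psexp f k).
Proof.
move=> pf; elim: k => [|k IHk]; first by rewrite expr0 -mpolyX0; apply: agree_psmono.
by rewrite exprS; apply: agree_psmul.
Qed.

End PowerSeries.

Section Substitution.
Variables (F : fieldType) (n : nat).

(** [insub] fails exactly on the last index, which receives [y]. *)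
Definition split_subst (S : Type) (x : 'I_n -> S) (y : S) (i : 'I_n.+1) : S :=
  if insub (val i) is Some j then x j else y.

Lemma split_subst_widen (S : Type) (x : 'I_n -> S) (y : S) i :
  split_subst x y (widen_ord (leqnSn n) i) = x i.
Proof. by rewrite /split_subst /= valK. Qed.

Lemma split_subst_max (S : Type) (x : 'I_n -> S) (y : S) : split_subst x y ord_max = y.
Proof. by rewrite /split_subst insubN //= ltnn. Qed.

Lemma mmap1_split (S : comNzRingType) (x : 'I_n -> S) y (m : 'X_{1..n.+1}) :
  mmap1 (split_subst x y) m = mmap1 x (mnm_init m) * y ^+ m ord_max.
Proof.
rewrite /mmap1 big_ord_recr /= split_subst_max; congr (_ * _).
by apply: eq_bigr => i _; rewrite split_subst_widen mnmE.
Qed.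

Lemma mdeg_split (m : 'X_{1..n.+1}) : mdeg m = (mdeg (mnm_init m) + m ord_max)%N.
Proof.
rewrite !mdegE big_ord_recr /=; congr (_ + _)%N.
by apply: eq_bigr => i _; rewrite mnmE.
Qed.

(** Coefficients of degree at most [d] of a product depend only on such coefficients of the factors,
    so a polynomial may stand in for [phi]. *)
Lemma agree_subst_last d (P : {mpoly F[n.+1]}) f (phi : pseries F n) : agree_upto d f phi ->
  agree_upto d (mmap (mpolyC n (R := F)) (split_subst (fun i => 'X_i) f) P) (ps_subst_last P phi).
Proof.
move=> fphi e ed; rewrite /mmap raddf_sum /=; apply: eq_bigr => m _.
rewrite mmap1_split mcoeffCM mmap1_id; congr (_ * _).
by apply: agree_psmul ed => //; [apply: agree_psmono|apply: agree_psexp].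
Qed.
End Substitution.

Lemma rmorph_mmap k (R : nzRingType) (S S' : comNzRingType) (g : {rmorphism S -> S'})
  (c : R -> S) (c' : R -> S') (h : 'I_k -> S) (h' : 'I_k -> S') (p : {mpoly R[k]}) :
  g \o c =1 c' -> g \o h =1 h' -> g (mmap c h p) = mmap c' h' p.
Proof.
move=> cc' hh'; rewrite /mmap rmorph_sum; apply: eq_bigr => m _.
rewrite rmorphM -cc' /mmap1 rmorph_prod; congr (_ * _).
by apply: eq_bigr => i _; rewrite rmorphXn -hh'.
Qed.

Section Homogeneous.
Variables (F : fieldType) (n k : nat).
Local Notation A := {mpoly F[n]}.
Implicit Types (p : {mpoly F[k]}) (w : 'I_k -> {poly A}).

(* The variable of [{poly A}] tracks total degree. *)
Definition graded_subst w : {mpoly F[k]} -> {poly A} :=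
  mmap (polyC \o mpolyC n (R := F)) (fun i => w i * 'X).

Lemma graded_substE w p :
  graded_subst w p = \sum_(m <- msupp p) (p@_m)%:MP%:P * mmap1 w m * 'X^(mdeg m).
Proof.
apply: eq_bigr => m _; rewrite /= -mulrA; congr (_ * _).
rewrite /mmap1 mdegE expr_sum -big_split /=.
by apply: eq_bigr => i _; rewrite exprMn.
Qed.

Lemma graded_subst_divXn w p d :
  (forall m, m \in msupp p -> (d < mdeg m)%N) -> exists r, graded_subst w p = r * 'X^(d.+1).
Proof.
move=> pd; exists (\sum_(m <- msupp p) (p@_m)%:MP%:P * mmap1 w m * 'X^(mdeg m - d.+1)).
rewrite graded_substE mulr_suml; apply: eq_big_seq => m /pd md.
by rewrite -!mulrA -exprD subnK.
Qed.

Lemma size_graded_subst (w : 'I_k -> A) p d :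
  (forall m, m \in msupp p -> (mdeg m <= d)%N) ->
  (size (graded_subst (fun i => (w i)%:P) p) <= d.+1)%N.
Proof.
move=> pd; rewrite graded_substE big_seq.
elim/big_ind: _ => [|x y xs ys|m /pd md]; first by rewrite size_poly0.
  by apply: leq_trans (size_polyD _ _) _; rewrite geq_max xs.
rewrite (_ : mmap1 _ m = (mmap1 w m)%:P); last first.
  by rewrite /mmap1 rmorph_prod; apply: eq_bigr => i _; rewrite rmorphXn.
rewrite -polyCM mul_polyC; apply: leq_trans (size_scale_leq _ _) _.
by rewrite size_polyXn.
Qed.

Lemma graded_subst_coef0 w p : (graded_subst w p)`_0 = (p@_0%MM)%:MP.
Proof.
rewrite graded_substE coef_sum.
have [p0|p0] := boolP (0%MM \in msupp p).
  rewrite (bigD1_seq _ p0 (msupp_uniq p)) /= mmap11 mulr1 mdeg0 expr0 mulr1 coefC eqxx.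
  rewrite big1 ?addr0 // => m; rewrite -mdeg_eq0 => m0.
  by rewrite coefMXn lt0n m0.
rewrite big_seq big1 => [|m mp]; first by rewrite memN_msupp_eq0 ?mpolyC0.
rewrite coefMXn lt0n mdeg_eq0.
by case: eqP mp p0 => // -> ->.
Qed.

End Homogeneous.

(** * Truncation of polynomials at total degree [d] *)

Section Truncation.
Variables (F : fieldType) (k d : nat).
Implicit Types (p : {mpoly F[k]}).

Definition trunc_mpoly p : {mpoly F[k]} := \sum_(m <- msupp p | (mdeg m <= d)%N) p@_m *: 'X_[m].

Lemma mcoeff_trunc_mpoly p m : (trunc_mpoly p)@_m = if (mdeg m <= d)%N then p@_m else 0.
Proof.
rewrite /trunc_mpoly raddf_sum /=.
have [mp|mp] := boolP (m \in msupp p); last first.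
  rewrite (memN_msupp_eq0 mp) if_same big_seq_cond big1 // => m' /andP[m'p _].
  by rewrite mcoeffZ mcoeffX; case: eqP mp => [<-|]; rewrite ?m'p ?mulr0.
rewrite big_mkcond (bigD1_seq _ mp (msupp_uniq p)) /= big1 ?addr0 => [|m' m'm].
  by case: ifP => // _; rewrite mcoeffZ mcoeffX eqxx mulr1.
by case: ifP => // _; rewrite mcoeffZ mcoeffX (negPf m'm) mulr0.
Qed.

Lemma mdeg_trunc_mpoly p m : m \in msupp (trunc_mpoly p) -> (mdeg m <= d)%N.
Proof. by rewrite mcoeff_msupp mcoeff_trunc_mpoly; case: ifP; rewrite ?eqxx. Qed.

Lemma mdeg_trunc_mpolyC p m : m \in msupp (p - trunc_mpoly p) -> (d < mdeg m)%N.
Proof.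
by rewrite mcoeff_msupp mcoeffB mcoeff_trunc_mpoly; case: leqP; rewrite ?subrr ?eqxx.
Qed.

Lemma graded_subst_trunc n (w : 'I_k -> {poly {mpoly F[n]}}) p :
  exists r, graded_subst w p = graded_subst w (trunc_mpoly p) + r * 'X^(d.+1).
Proof.
have [r rE] := graded_subst_divXn w (@mdeg_trunc_mpolyC p).
by exists r; rewrite -rE -raddfD /= addrC subrK.
Qed.

End Truncation.

(** * Expansion of product gates *)

Section ProductExpansion.
Variables (F : fieldType) (n : nat) (C : circuit F n).
Hypothesis wfC : wires_wf C.

Local Notation gate_at := (nth (GConst n 0) C).
Local Notation val_at := (nth 0 (vals C)).
Local Notation depth_at := (nth 0%N (depths C)).
Local Notation s := (circuit_size C).

(** Size counts wires, so it does not bound the number of gates; it does bound the number of gates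
    that are read. *)
Definition wire_sources : seq nat :=
  undup (flatten [seq map fst (gate_wires (gate_at k)) | k <- iota 0 (size C)]).

Definition is_mul (g : gate F n) := if g is GMul _ then true else false.

Lemma circuit_sizeE : s = \sum_(k <- iota 0 (size C)) size (gate_wires (gate_at k)).
Proof. by rewrite /circuit_size (big_nth (GConst n 0)) /index_iota subn0. Qed.

Lemma size_wire_sources : (size wire_sources <= s)%N.
Proof.
apply: leq_trans (size_undup _) _.
rewrite size_flatten /shape -map_comp circuit_sizeE sumnE big_map.
by apply: leq_sum => k _; rewrite /= size_map.
Qed.

Lemma mem_wire_sources k w : (k < size C)%N -> w \in gate_wires (gate_at k) -> w.1 \in wire_sources.
Proof.
move=> kC wk; rewrite mem_undup; apply/flattenP; exists (map fst (gate_wires (gate_at k))).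
  by apply/mapP; exists k; rewrite // mem_iota.
exact: map_f.
Qed.

Lemma size_gate_wires k : (k < size C)%N -> (size (gate_wires (gate_at k)) <= s)%N.
Proof.
by move=> kC; rewrite circuit_sizeE (big_rem k) ?mem_iota //= leq_addr.
Qed.

Lemma depth_wire k w : (k < size C)%N -> w \in gate_wires (gate_at k) -> (depth_at w.1 < depth_at k)%N.
Proof.
move=> kC wk; rewrite (nth_depths wfC kC).
by case: (gate_at k) wk => // ws /= wk; rewrite ltnS; exact: (@leq_bigmax_seq _ ws xpredT (fun u : nat * F => depth_at u.1) w).
Qed.

(* The exponent [mu h] counts the paths of product gates from [k] to [h], so it
   may be exponential in the depth, but only in the depth between [k] and [h]. *)
Lemma product_expansion k : (k < size C)%N -> is_mul (gate_at k) ->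
  exists (c : F) (mu : nat -> nat),
    val_at k = c *: \prod_(h <- wire_sources) val_at h ^+ mu h /\
    forall h, (0 < mu h)%N ->
      [/\ (h < k)%N, ~~ is_mul (gate_at h), (depth_at h < depth_at k)%N
        & (mu h <= s ^ (depth_at k - depth_at h))%N].
Proof.
elim/ltn_ind: k => k IHk kC mulk.
(* The sharper bound allows [s ^ (depth difference - 1)] per wire and is proved by induction on the
   wires; there are at most [s] of them. *)
suff [c [mu [prodE muP]]] : exists (c : F) (mu : nat -> nat),
    \prod_(w <- gate_wires (gate_at k)) (w.2 *: val_at w.1)
       = c *: \prod_(h <- wire_sources) val_at h ^+ mu h /\
    forall h, (0 < mu h)%N ->
      [/\ (h < k)%N, ~~ is_mul (gate_at h), (depth_at h < depth_at k)%N
        & (mu h <= size (gate_wires (gate_at k)) * s ^ (depth_at k - depth_at h).-1)%N].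
  exists c, mu; split.
    by rewrite (nth_vals wfC kC) -prodE; case: (gate_at k) mulk.
  move=> h /muP[hk nh dh muh]; split=> //; apply: leq_trans muh _.
  rewrite -[in leqRHS](prednK (n := depth_at k - depth_at h)) ?subn_gt0 // expnS.
  by rewrite leq_mul2r size_gate_wires ?orbT.
have := fun w => @mem_wire_sources k w kC; have := fun w => @depth_wire k w kC.
have := fun w => wires_wfP (w := w) wfC kC.
have := size_gate_wires kC.
elim: (gate_wires (gate_at k)) => [|w ws IHws] szw wk dw ws_src.
  exists 1, (fun=> 0%N); split=> //.
  by rewrite big_nil big1 ?scale1r // => h _; rewrite expr0.
have s0 : (0 < s)%N by apply: leq_trans szw.
have [||||c2 [mu2 [prod2 mu2P]]] := IHws.
- exact: ltnW szw.
- by move=> u uws; apply: wk; rewrite inE uws orbT.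
- by move=> u uws; apply: dw; rewrite inE uws orbT.
- by move=> u uws; apply: ws_src; rewrite inE uws orbT.
have wws := mem_head w ws.
(* A wire from a product gate is expanded by the induction hypothesis, losing at least one layer;
   any other source is a factor itself. *)
have [c1 [mu1 [prod1 mu1P]]] : exists (c : F) (mu : nat -> nat),
    val_at w.1 = c *: \prod_(h <- wire_sources) val_at h ^+ mu h /\
    forall h, (0 < mu h)%N ->
      [/\ (h < k)%N, ~~ is_mul (gate_at h), (depth_at h < depth_at k)%N
        & (mu h <= s ^ (depth_at k - depth_at h).-1)%N].
  have [mulw|nmulw] := boolP (is_mul (gate_at w.1)).
    have [|c [mu [valw muP]]] := IHk _ (wk _ wws) _ mulw; first exact: ltn_trans (wk _ wws) kC.
    exists c, mu; split=> // h /muP[hw nh dh muh]; split=> //.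
    - exact: ltn_trans (wk _ wws).
    - exact: ltn_trans (dw _ wws).
    apply: leq_trans muh _; apply: leq_pexp2l => //.
    by have := dw _ wws; lia.
  exists 1, (fun h => (h == w.1) : nat); split.
    rewrite scale1r (bigD1_seq w.1) ?undup_uniq ?ws_src //= eqxx expr1.
    by rewrite big1 ?mulr1 // => h /negPf ->.
  move=> h; case: eqP => // -> _; split=> //; [exact: wk|exact: dw|].
  by rewrite expn_gt0 s0.
exists (w.2 * c1 * c2), (fun h => mu1 h + mu2 h)%N; split.
  rewrite big_cons prod2 prod1 scalerA -scalerAl -scalerAr scalerA; congr (_ *: _).
  by rewrite -big_split; apply: eq_bigr => h _; rewrite exprD.
move=> h; rewrite addn_gt0 => muh.
have [hk nh dh] : [/\ (h < k)%N, ~~ is_mul (gate_at h) & (depth_at h < depth_at k)%N].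
  by case/orP: muh => [/mu1P|/mu2P] [].
split=> //; rewrite /= mulSn; apply: leq_add.
  by have [/mu1P[]//|] := ltnP 0 (mu1 h); rewrite leqn0 => /eqP ->.
by have [/mu2P[]//|] := ltnP 0 (mu2 h); rewrite leqn0 => /eqP ->.
Qed.

End ProductExpansion.

(** * Truncation of circuits *)

Lemma size_index_enum (T : finType) : size (index_enum T) = #|T|.
Proof. by rewrite -sum1_size sum1_card. Qed.

Lemma size_prod_le (B : comNzRingType) (I : eqType) (r : seq I) (f : I -> {poly B}) e :
  (forall i, i \in r -> (size (f i) <= e.+1)%N) -> (size (\prod_(i <- r) f i)%R <= (size r * e).+1)%N.
Proof.
elim: r => [|i r IHr] fe; first by rewrite big_nil size_poly1.
rewrite big_cons; apply: leq_trans (size_polyMleq _ _) _.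
have := fe i (mem_head _ _); have := IHr (fun j jr => fe j (@mem_behead _ (i :: r) j jr)).
by rewrite /= mulSn; set a := size _; set b := size _; set x := (_ * e)%N; lia.
Qed.

(** * Congruence modulo a power of the variable *)

Section CongruenceModXn.
Variables (B : comNzRingType) (e : nat).
Implicit Types p q : {poly B}.

Definition eqmodXn p q := exists r, p = q + r * 'X^e.

Lemma eqmodXn_refl p : eqmodXn p p.
Proof. by exists 0; ring. Qed.

Lemma eqmodXn_trans p q r : eqmodXn p q -> eqmodXn q r -> eqmodXn p r.
Proof. by move=> [u ->] [v ->]; exists (v + u); ring. Qed.

Lemma eqmodXn_sym p q : eqmodXn p q -> eqmodXn q p.
Proof. by move=> [u ->]; exists (- u); ring. Qed.

Lemma eqmodXn_add p p' q q' : eqmodXn p p' -> eqmodXn q q' -> eqmodXn (p + q) (p' + q').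
Proof. by move=> [u ->] [v ->]; exists (v + u); ring. Qed.

Lemma eqmodXn_mul p p' q q' : eqmodXn p p' -> eqmodXn q q' -> eqmodXn (p * q) (p' * q').
Proof. by move=> [u ->] [v ->]; exists (u * q' + p' * v + u * v * 'X^e); ring. Qed.

Lemma eqmodXn_exp p p' k : eqmodXn p p' -> eqmodXn (p ^+ k) (p' ^+ k).
Proof.
by move=> pp'; elim: k => [|k IHk]; [apply: eqmodXn_refl|rewrite !exprS; apply: eqmodXn_mul].
Qed.

Lemma eqmodXn_sum (I : eqType) (r : seq I) (f g : I -> {poly B}) :
  (forall i, i \in r -> eqmodXn (f i) (g i)) -> eqmodXn (\sum_(i <- r) f i) (\sum_(i <- r) g i).
Proof.
move=> fg; rewrite big_seq [X in eqmodXn _ X]big_seq.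
by elim/big_rec2: _ => [|i x y ir xy]; [apply: eqmodXn_refl|apply: eqmodXn_add => //; apply: fg].
Qed.

Lemma eqmodXn_prod (I : eqType) (r : seq I) (f g : I -> {poly B}) :
  (forall i, i \in r -> eqmodXn (f i) (g i)) -> eqmodXn (\prod_(i <- r) f i) (\prod_(i <- r) g i).
Proof.
move=> fg; rewrite big_seq [X in eqmodXn _ X]big_seq.
by elim/big_rec2: _ => [|i x y ir xy]; [apply: eqmodXn_refl|apply: eqmodXn_mul => //; apply: fg].
Qed.

Lemma eqmodXn_take p : eqmodXn p (take_poly e p).
Proof. by exists (drop_poly e p); rewrite poly_take_drop. Qed.

Lemma eqmodXn_take_eq p q : eqmodXn p q -> (size q <= e)%N -> take_poly e p = q.
Proof.
move=> [r ->] sq; apply/polyP => i; rewrite coef_take_poly coefD coefMXn.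
by case: ltnP => [|ei]; rewrite ?addr0 // nth_default // (leq_trans sq).
Qed.

End CongruenceModXn.

Section TruncatedPower.
Variables (F : fieldType) (B : comNzRingType) (iota : {rmorphism F -> {poly B}}).

(** This is the Taylor polynomial of order [d] of [X^m] at [c]. *)
Definition trunc_pow (d : nat) (c : F) (m : nat) : {poly F} := 'X^m %% ('X - c%:P) ^+ d.+1.

Lemma size_trunc_pow d c m : (size (trunc_pow d c m) <= d.+1)%N.
Proof.
rewrite -ltnS -(size_exp_XsubC d.+1 c) ltn_modp.
by rewrite -size_poly_gt0 size_exp_XsubC.
Qed.

(* Modulo [X^d.+1] an arbitrarily high power of [H] is a polynomial of degree at
   most [d] in [H], with scalar coefficients since [H] has a scalar constant term. *)
Lemma trunc_pow_eqmod d c m (H : {poly B}) (c' : B) : iota c = c'%:P -> H`_0 = c' ->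
  eqmodXn d.+1 (H ^+ m) (map_poly iota (trunc_pow d c m)).[H].
Proof.
move=> ic H0; have [r rE] : exists r, H - c'%:P = r * 'X.
  by apply: poly_coef0_divX; rewrite coefB coefC eqxx H0 subrr.
(* The division of [X^m] is evaluated at [H], where the divisor becomes [(r X)^(d+1)]. *)
exists ((map_poly iota ('X^m %/ ('X - c%:P) ^+ d.+1)).[H] * r ^+ d.+1).
have := congr1 (fun p => (map_poly iota p).[H]) (divp_eq 'X^m (('X - c%:P) ^+ d.+1)).
rewrite /= rmorphD rmorphM !rmorphXn /= map_polyX rmorphB /= map_polyX map_polyC /=.
rewrite hornerD hornerM !horner_exp hornerX hornerXsubC ic rE exprMn => ->.
by rewrite mulrA addrC.
Qed.
End TruncatedPower.

(** * Simulating a circuit modulo [lam^(d+1)] through values at nodes *)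

Section CircuitTruncation.
Variables (F : fieldType) (n m : nat).
Local Notation A := {mpoly F[n]}.
Variables (C : circuit F m) (wfC : wires_wf C) (d : nat) (d0 : (0 < d)%N).
Variable w : 'I_m -> A.
Hypothesis w_obtainable : forall (C' : circuit F n) i e, obtainable C' (w i) e 0.
Local Notation s := (circuit_size C).
(** Bounds the degree in [lam] of a product representative: at most [s] sources, each contributing a
    polynomial in [H] of degree at most [s^2] or [d], with [H] of degree at most [d]. *)
Definition fiber_degree (s d : nat) : nat := (s.+1 * ((s ^ 2 + d) * d))%N.
Variable L : seq F.
Hypotheses (uniqL : uniq L) (sizeL : size L = (fiber_degree s d).+1).

Local Notation gate_at := (nth (GConst m 0) C).
Local Notation val_at := (nth 0 (vals C)).
Local Notation depth_at := (nth 0%N (depths C)).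
Local Notation psi := (graded_subst (fun i => (w i)%:P)).

(** The weight of the value at node [u] when a polynomial is interpolated, cut at degree [d] and
    evaluated at [t]. *)
Definition trunc_coef (u t : F) : F := \sum_(i < d.+1) (lagrange_basis L u)`_i * t ^+ i.

Lemma horner_trunc (H : {poly A}) t : (size H <= size L)%N ->
  (take_poly d.+1 H).[t%:MP] = \sum_(u <- L) trunc_coef u t *: H.[u%:MP].
Proof.
move=> sH; rewrite /take_poly horner_poly.
under eq_bigr => i _.
  rewrite (interpolation (mpolyC n (R := F)) i uniqL sH) mulr_suml.
  over.
rewrite exchange_big /=; apply: eq_bigr => u _.
rewrite /trunc_coef scaler_suml; apply: eq_bigr => i _.
by rewrite -mul_mpolyC rmorphM rmorphXn /=; ring.
Qed.

(** The representative [H] is present only through its values at the nodes, each at the depth of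
    gate [k] in [C], so the simulation adds no layer. Product gates may exceed degree [d], as
    cutting them would need a further sum gate. *)
Record good (C1 : circuit F n) (k : nat) (H : {poly A}) : Prop := Good {
  good_eqmod : eqmodXn d.+1 (psi (val_at k)) H;
  good_size : (size H <= size L)%N;
  good_size_nmul : ~~ is_mul (gate_at k) -> (size H <= d.+1)%N;
  good_available : forall t, t \in L -> available C1 H.[t%:MP] (depth_at k) }.

Lemma good_extends C1 C2 k H : extends C1 C2 -> good C1 k H -> good C2 k H.
Proof.
move=> CC [? ? ? av]; split=> // t /av; exact: available_extends.
Qed.

Lemma horner_trunc_pow (q : {poly F}) (H : {poly A}) t : 
  ((map_poly (polyC \o mpolyC n (R := F)) q).[H]).[t%:MP] = \sum_(i < size q) q`_i *: H.[t%:MP] ^+ i.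
Proof.
rewrite [(map_poly _ q).[H]]horner_coef size_map_poly.
rewrite horner_sum; apply: eq_bigr => i _.
by rewrite coef_map /= hornerM hornerC horner_exp mul_mpolyC.
Qed.

(** For each node, the first summand pays for a sum gate reading all values of its sources, the
    second for a product gate with at most [s^2 + 1] factors per source. *)
Definition step_cost (s d : nat) : nat :=
  ((fiber_degree s d).+1 *
   (s * (fiber_degree s d).+1 + s * (s ^ 2).+1 * (d.+1 * d.+1).+1))%N.

Lemma good_step C1 k (Hf : nat -> {poly A}) : wires_wf C1 -> (k < size C)%N ->
  (forall j, j \in wire_sources C -> (j < k)%N -> good C1 j (Hf j)) ->
  exists H C2, [/\ extends C1 C2, good C2 k H & (circuit_size C2 <= circuit_size C1 + step_cost s d)%N].
Proof.
move=> wf1 kC Hgood.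
suff [H [Heq Hs Hs' Hob]] : exists H, [/\ eqmodXn d.+1 (psi (val_at k)) H, (size H <= size L)%N,
    ~~ is_mul (gate_at k) -> (size H <= d.+1)%N
    & forall t, t \in L -> obtainable C1 H.[t%:MP] (depth_at k)
       (s * (fiber_degree s d).+1 + s * (s ^ 2).+1 * (d.+1 * d.+1).+1)].
  have [C2 [C12 av le]] := obtain_all Hob (extends_refl wf1).
  by exists H, C2; split=> //; rewrite sizeL in le.
have dL : (d.+1 <= size L)%N.
  by rewrite sizeL ltnS /fiber_degree; nia.
have src := fun u => @mem_wire_sources _ _ C k u kC.
have wk := fun u => wires_wfP (w := u) wfC kC.
have depth_lt := fun u => @depth_wire _ _ C wfC k u kC.
have szw := size_gate_wires kC.
rewrite (nth_vals wfC kC) /is_mul.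
case gk : (gate_at k) src wk depth_lt szw => [i|c|ws|ws] /= src wk depth_lt szw.
- exists ((w i)%:P * 'X).
  have sz : (size ((w i)%:P * 'X : {poly A})%R <= d.+1)%N.
    rewrite mul_polyC; apply: leq_trans (size_scale_leq _ _) _.
    by rewrite size_polyX.
  split=> //; [|exact: leq_trans dL|move=> t _].
    by rewrite /graded_subst mmapX mmap1U; apply: eqmodXn_refl.
  rewrite hornerM hornerC hornerX mulrC mul_mpolyC.
  exact/obtainableZ/(obtainableW (leqnn _) (leq0n _))/w_obtainable.
- exists c%:MP%:P.
  have sz : (size (c%:MP%:P : {poly A})%R <= d.+1)%N by apply: leq_trans (size_polyC_leq1 _) _.
  split=> //; [|exact: leq_trans dL|move=> t _].
    by rewrite /graded_subst mmapC; apply: eqmodXn_refl.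
  rewrite hornerC.
  exact/(obtainableW (leqnn _) (leq0n _))/obtainable_const.
- pose H0 : {poly A} := \sum_(u <- ws) u.2%:MP%:P * Hf u.1.
  have H0s : (size H0 <= size L)%N.
    rewrite /H0 big_seq; elim/big_ind: _ => [|x y xs ys|u /[dup] uws /wk uk].
    - by rewrite size_poly0.
    - by apply: leq_trans (size_polyD _ _) _; rewrite geq_max xs.
    rewrite mul_polyC; apply: leq_trans (size_scale_leq _ _) _.
    exact: good_size (Hgood _ (src _ uws) uk).
  exists (take_poly d.+1 H0).
  have sz := size_take_poly d.+1 H0.
  split=> //; [|exact: leq_trans dL|move=> t tL].
    apply: eqmodXn_trans (eqmodXn_take _ _); rewrite /graded_subst raddf_sum.
    apply: eqmodXn_sum => u uws; rewrite /= mmapZ /=.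
    apply: eqmodXn_mul; first exact: eqmodXn_refl.
    exact: good_eqmod (Hgood _ (src _ uws) (wk _ uws)).
  rewrite horner_trunc //.
  (* The sum over nodes and the sum over wires merge into one sum gate, with the truncation weights
     put on its wires. *)
  rewrite (_ : \sum_(u <- L) _ = \sum_(v <- [seq (x, y) | x <- ws, y <- L])
      (v.1.2 * trunc_coef v.2 t) *: (Hf v.1.1).[v.2%:MP]); last first.
    rewrite big_allpairs /= exchange_big /=; apply: eq_bigr => u _.
    rewrite horner_sum scaler_sumr; apply: eq_bigr => v _.
    by rewrite hornerM hornerC mul_mpolyC scalerA mulrC.
  have -> : depth_at k = (\max_(u <- ws) depth_at u.1).+1 by rewrite (nth_depths wfC kC) gk.
  apply: (obtainableW (leqnn _)); last first.
    apply: (obtainable_sum (k := 0)) => -[u v] /allpairsP[[u' v'] /= [uws vL [-> ->]]].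
    apply/obtainableZ/available_obtainable.
    apply: availableW (good_available (Hgood _ (src _ uws) (wk _ uws)) vL).
    exact: (@leq_bigmax_seq _ ws xpredT (fun u : nat * F => depth_at u.1) u').
  rewrite size_allpairs muln1 sizeL; apply: leq_trans (leq_addr _ _).
  by rewrite leq_mul2r szw orbT.
have mulk : is_mul (gate_at k) by rewrite gk.
have [c [mu [valE muP]]] := product_expansion wfC kC mulk.
pose iota : {rmorphism F -> {poly A}} := polyC \o mpolyC n (R := F).
pose q h := trunc_pow d (val_at h)@_0%MM (mu h).
(* Exponents up to [s^2] are kept as repeated wires; larger powers are replaced by a polynomial of
   degree at most [d] in [Hf h]. *)
pose fac h : {poly A} := if (mu h <= s ^ 2)%N then Hf h ^+ mu h else (map_poly iota (q h)).[Hf h].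
have good_mu h : h \in wire_sources C -> (0 < mu h)%N -> good C1 h (Hf h).
  by move=> hR /muP[hk _ _ _]; apply: Hgood.
have size_Hf h : h \in wire_sources C -> (0 < mu h)%N -> (size (Hf h) <= d.+1)%N.
  by move=> hR mu0; have [_ nh _ _] := muP _ mu0; exact: (good_size_nmul (good_mu _ hR mu0) nh).
have size_pow h j : h \in wire_sources C -> (0 < mu h)%N -> (size (Hf h ^+ j) <= (j * d).+1)%N.
  move=> hR mu0; apply: leq_trans (size_poly_exp_leq _ _) _.
  rewrite ltnS mulnC leq_mul2l; apply/orP; right.
  by have := size_Hf h hR mu0; case: (size (Hf h)).
have size_fac h : h \in wire_sources C -> (size (fac h) <= ((s ^ 2 + d) * d).+1)%N.
  move=> hR; rewrite /fac; case: ifP => [le|/negbT].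
    have [mu0|mu0] := posnP (mu h); first by rewrite mu0 expr0 size_poly1.
    apply: leq_trans (size_pow _ _ hR mu0) _.
    by rewrite ltnS leq_mul2r (leq_trans le (leq_addr _ _)) orbT.
  rewrite -ltnNge => le; have mu0 : (0 < mu h)%N by apply: leq_ltn_trans le.
  rewrite horner_coef; elim/big_ind: _ => [|x y xs ys|i _]; first by rewrite size_poly0.
    by apply: leq_trans (size_polyD _ _) _; rewrite geq_max xs.
  rewrite coef_map /= mul_polyC; apply: leq_trans (size_scale_leq _ _) _.
  apply: leq_trans (size_pow _ _ hR mu0) _.
  rewrite ltnS leq_mul2r; apply/orP; right.
  apply: leq_trans (leq_addl _ _); rewrite -ltnS.
  apply: leq_trans (ltn_ord i) _; rewrite size_map_poly; exact: size_trunc_pow.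
exists (c%:MP%:P * \prod_(h <- wire_sources C) fac h).
split=> //.
- have -> : \prod_(u <- ws) (u.2 *: val_at u.1) = val_at k by rewrite (nth_vals wfC kC) gk.
  rewrite valE /graded_subst mmapZ /=; apply: eqmodXn_mul; first exact: eqmodXn_refl.
  rewrite rmorph_prod; apply: eqmodXn_prod => h hR; rewrite rmorphXn /=.
  have [mu0|mu0] := posnP (mu h); first by rewrite /fac mu0 !expr0; apply: eqmodXn_refl.
  apply: eqmodXn_trans (eqmodXn_exp _ (good_eqmod (good_mu _ hR mu0))) _.
  rewrite /fac; case: ifP => _; first exact: eqmodXn_refl.
  apply: (@trunc_pow_eqmod _ _ iota d _ _ _ ((val_at h)@_0%MM)%:MP) => //.
  have [r] := good_eqmod (good_mu _ hR mu0).
  move=> /(congr1 (fun p : {poly A} => p`_0)); rewrite graded_subst_coef0 => ->.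
  by rewrite coefD coefMXn addr0.
- rewrite mul_polyC; apply: leq_trans (size_scale_leq _ _) _.
  rewrite sizeL /fiber_degree.
  apply: (@leq_trans (size (wire_sources C) * ((s ^ 2 + d) * d)).+1).
    exact: size_prod_le size_fac.
  by rewrite ltnS leq_mul2r (leq_trans (size_wire_sources C)) ?orbT.
move=> t tL; rewrite hornerM hornerC mul_mpolyC; apply: obtainableZ.
rewrite horner_prod.
pose fs h := if (mu h <= s ^ 2)%N then nseq (mu h) (Hf h).[t%:MP]
             else [:: ((map_poly iota (q h)).[Hf h]).[t%:MP]].
have -> : \prod_(h <- wire_sources C) (fac h).[t%:MP] =
          \prod_(p <- flatten [seq fs h | h <- wire_sources C]) p.
  rewrite big_flatten big_map; apply: eq_bigr => h _; rewrite /fac /fs.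
  case: ifP => _; last by rewrite big_seq1.
  by rewrite horner_exp big_nseq -Monoid.iteropE.
have depth_gt0 : (0 < depth_at k)%N by rewrite (nth_depths wfC kC) gk.
rewrite -(prednK depth_gt0).
apply: (obtainableW (leqnn _)); last first.
  apply: (obtainable_prod (k := d.+1 * d.+1)) => p /flattenP[_ /mapP[h hR ->]].
  rewrite /fs; case: ifP => [le /nseqP[-> mu0]|/negbT].
    have [_ _ dh _] := muP _ mu0.
    apply: (obtainableW (leqnn _) (leq0n _)); apply: available_obtainable.
    by apply: availableW (good_available (good_mu _ hR mu0) tL); rewrite -ltnS prednK.
  rewrite -ltnNge => lt /predU1P[->|//].
  have mu0 : (0 < mu h)%N by apply: leq_ltn_trans lt.
  have [_ _ dh leh] := muP _ mu0.
  have s0 : (0 < s)%N by apply: leq_trans (size_wire_sources C); case: (wire_sources C) hR.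
  (* Since [s^2 < mu h] and [mu h] is at most [s] to the depth difference, that difference is at
     least 3: one layer for the powers of [Hf h], one for their combination, one for the gate
     itself. *)
  have depth3 : (2 < depth_at k - depth_at h)%N.
    by have := leq_trans lt leh; rewrite ltnNge; apply: contraR; rewrite -leqNgt => ?; apply: leq_pexp2l.
  rewrite horner_trunc_pow.
  apply: (@obtainableW _ _ _ _ (depth_at h).+2); [by lia| |]; last first.
    apply: (obtainable_sum (k := d)) => i _; apply: obtainableZ.
    rewrite -[X in _ ^+ X]card_ord -prodr_const.
    apply: (obtainableW (leqnn _)); last first.
      apply: (obtainable_prod (k := 0)) => j _.
      exact/available_obtainable/(good_available (good_mu _ hR mu0) tL).
    rewrite muln1 size_index_enum card_ord -ltnS; apply: leq_trans (ltn_ord i) _; exact: size_trunc_pow.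
  rewrite size_index_enum card_ord leq_mul2r; apply/orP; right; exact: size_trunc_pow.
apply: leq_trans (leq_addl _ _); rewrite leq_mul2r /=.
rewrite size_flatten /shape -map_comp sumnE big_map.
apply: (@leq_trans (\sum_(h <- wire_sources C) (s ^ 2).+1)).
  apply: leq_sum => h _; rewrite /= /fs; case: ifP => // le; rewrite size_nseq; exact: leqW.
by rewrite big_const_seq count_predT iter_addn_0 mulnC leq_mul2r size_wire_sources orbT.
Qed.

(** Only gates that are read, and the output, are simulated; this limits the number of steps to
    [s + 1]. *)
Definition relevant k := (k \in wire_sources C) || (k == (size C).-1).

Lemma good_all (C0 : circuit F n) : wires_wf C0 -> forall K, (K <= size C)%N ->
  exists (C1 : circuit F n) (Hf : nat -> {poly A}),
    [/\ extends C0 C1, forall k, (k < K)%N -> relevant k -> good C1 k (Hf k)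
      & (circuit_size C1 <= circuit_size C0 + \sum_(k <- iota 0 K | relevant k) step_cost s d)%N].
Proof.
move=> wf0; elim=> [|K IHK] KC.
  by exists C0, (fun=> 0); rewrite big_nil addn0; split=> //; apply: extends_refl.
have [C1 [Hf [C01 goodC1 le1]]] := IHK (ltnW KC).
rewrite -addn1 iotaD big_cat /= big_cons big_nil add0n addn1.
case: ifP => [relK|nrelK]; last first.
  exists C1, Hf; split; rewrite ?addn0=> // k; rewrite ltnS leq_eqVlt => /predU1P[->|].
    by rewrite nrelK.
  exact: goodC1.
have [|H [C2 [C12 goodK le2]]] := @good_step C1 K Hf (extends_wf C01) KC.
  by move=> j jR jK; apply: goodC1 => //; rewrite /relevant jR.
exists C2, (fun k => if k == K then H else Hf k); split.
- exact: extends_trans C12.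
- move=> k; rewrite ltnS leq_eqVlt; case: eqP => [-> //|_] /= kK relk.
  exact: good_extends C12 (goodC1 _ kK relk).
by apply: leq_trans le2 _; rewrite addn0 addnA leq_add2r.
Qed.

Lemma count_relevant : (count relevant (iota 0 (size C)) <= s.+1)%N.
Proof.
rewrite -size_filter; apply: (@leq_trans (size ((size C).-1 :: wire_sources C))).
  apply: uniq_leq_size; first by rewrite filter_uniq // iota_uniq.
  by move=> k; rewrite mem_filter inE orbC => /andP[].
by rewrite /= ltnS size_wire_sources.
Qed.

Definition trunc_cost (s d : nat) : nat := (s.+1 * step_cost s d + (fiber_degree s d).+1)%N.

(** The output may be a product gate with an uncut representative. One more sum gate cuts it and
    evaluates at [lam = 1], hence the extra layer. *)
Lemma trunc_obtainable (C0 : circuit F n) : (0 < size C)%N ->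
  obtainable C0 (mmap (mpolyC n (R := F)) w (trunc_mpoly d (circuit_output C)))
    (circuit_depth C).+1 (trunc_cost s d).
Proof.
move=> C_gt0 C' CC'; set P := circuit_output C.
have lastC : ((size C).-1 < size C)%N by rewrite prednK.
have [C1 [Hf [C'1 goodC1 le1]]] := good_all (extends_wf CC') (leqnn _).
have goodl : good C1 (size C).-1 (Hf (size C).-1).
  by apply: goodC1 => //; rewrite /relevant eqxx orbT.
set H := Hf _ in goodl.
have PE : val_at (size C).-1 = P by rewrite -size_vals nth_last.
have DE : depth_at (size C).-1 = circuit_depth C by rewrite -size_depths nth_last.
have sz : (size (psi (trunc_mpoly d P)) <= d.+1)%N.
  by apply: size_graded_subst => i; apply: mdeg_trunc_mpoly.
have -> : mmap (mpolyC n (R := F)) w (trunc_mpoly d P) = (take_poly d.+1 H).[1%:MP].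
  rewrite (eqmodXn_take_eq (q := psi (trunc_mpoly d P))) //; last first.
    apply: eqmodXn_trans (eqmodXn_sym (good_eqmod goodl)) _.
    by rewrite PE; apply: graded_subst_trunc.
  apply/esym/(@rmorph_mmap _ _ _ _ (horner_eval (1%:MP : A))) => i /=.
    by rewrite horner_evalE hornerC.
  by rewrite horner_evalE hornerM hornerC hornerX mulr1.
rewrite horner_trunc ?(good_size goodl) //.
have ob : obtainable C1 (\sum_(u <- L) trunc_coef u 1 *: H.[u%:MP])
    (circuit_depth C).+1 (size L * 1).
  apply: obtainable_sum => u uL; apply/obtainableZ/available_obtainable.
  by rewrite -DE; apply: (good_available goodl).
have [C2 [C12 av le2]] := ob _ (extends_refl (extends_wf C'1)).
exists C2; split=> //; first exact: extends_trans C12.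
apply: leq_trans le2 _; rewrite muln1 sizeL /trunc_cost addnA leq_add2r.
apply: leq_trans le1 _; rewrite leq_add2l big_const_seq iter_addn_0 mulnC leq_mul2r.
by rewrite count_relevant orbT.
Qed.
End CircuitTruncation.

(** * The root as a coefficient *)

(** Differentiation is linear in the values at the nodes, so values of the derivative cost one sum
    gate. *)
Lemma deriv_interpolation (F : fieldType) (B : idomainType) (iota : {rmorphism F -> B}) (L : seq F) (p : {poly B}) x :
  uniq L -> (size p <= size L)%N ->
  p^`().[iota x] = \sum_(u <- L) iota (lagrange_basis L u)^`().[x] * p.[iota u].
Proof.
move=> uL sp.
have {1}-> : p = \sum_(u <- L) p.[iota u] *: map_poly iota (lagrange_basis L u).
  apply/polyP => i; rewrite coef_sum (interpolation iota i uL sp).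
  by apply: eq_bigr => u _; rewrite coefZ coef_map mulrC.
rewrite raddf_sum horner_sum; apply: eq_bigr => u _.
by rewrite /= derivZ hornerZ deriv_map horner_map mulrC.
Qed.

Lemma meval_zero (R : comNzRingType) k (p : {mpoly R[k]}) : p.@[fun=> 0] = p@_0%MM.
Proof.
have monE (m : 'X_{1..k}) : \prod_(i < k) (0 : R) ^+ m i = (m == 0%MM)%:R.
  by rewrite -expr_sum -mdegE expr0n mdeg_eq0.
rewrite mevalE; under eq_bigr => m _ do rewrite monE.
have [p0|p0] := boolP (0%MM \in msupp p).
  rewrite (bigD1_seq _ p0 (msupp_uniq p)) /= eqxx mulr1 big1 ?addr0 // => m /negPf ->.
  by rewrite mulr0.
rewrite (memN_msupp_eq0 p0) big_seq big1 // => m mp.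
by case: eqP mp p0 => [-> ->|_ _ _] //; rewrite mulr0.
Qed.

Section LowCoefficients.
Variable B : comNzRingType.

(** With [coef10_mulXsub], this computes the coefficient of [y] in [p] at [lam = 0] in two ways;
    comparing them shows that the cofactor of [y - f] has constant term 1. *)
Lemma coef10_monic (a b : {poly {poly B}}) : ('X - ('X^2 * a + 'X%:P * b))`_1`_0 = 1.
Proof.
by rewrite coefB coefX /= coefB coefD coefXnM coefCM /= add0r coefXM coef1 subr0.
Qed.

Lemma coef10_mulXsub (q : {poly {poly B}}) (g r : {poly B}) : g`_0 = 0 ->
  (q * ('X - g%:P) + r%:P)`_1`_0 = q`_0`_0.
Proof.
move=> g0; rewrite mulrBr coefD coefB coefMX coefMC coefC /= addr0 coefB.
by rewrite coef0M g0 mulr0 subr0.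
Qed.
End LowCoefficients.

Section PowerSeriesRoot.
Variables (F : fieldType) (n d : nat) (d0 : (0 < d)%N).
Local Notation A := {mpoly F[n]}.
Local Notation lam := (('X : {poly A})%:P : {poly {poly A}}).
Variables (P : {mpoly F[n.+1]}) (phi : pseries F n).
Hypotheses (phi0 : phi 0%MM = 0) (Pphi : ps_subst_last P phi = fun=> 0).
Let alpha := (P^`M(ord_max)).@[fun=> 0].
Hypothesis alpha0 : alpha != 0.

Local Notation P' := (trunc_mpoly d P).
Local Notation f := (trunc_ps d phi).

Definition poly2C (c : F) : {poly {poly A}} := c%:MP%:P%:P.
HB.instance Definition _ := GRing.RMorphism.copy poly2C (polyC \o polyC \o mpolyC n (R := F)).

(** This is [P(lam x, y)]: the outer variable is [y], the inner one [lam]. *)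
Definition bivariate : {mpoly F[n.+1]} -> {poly {poly A}} :=
  mmap poly2C (split_subst (fun j => ('X_j)%:P%:P * lam) 'X).
HB.instance Definition _ := GRing.RMorphism.on bivariate.

Definition graded_series : {poly A} := graded_subst (fun j : 'I_n => ('X_j)%:P) f.
Local Notation fh := graded_series.

Lemma graded_series_coef0 : fh`_0 = 0.
Proof. by rewrite graded_subst_coef0 agree_trunc_ps ?mdeg0 // phi0. Qed.

Lemma size_graded_series : (size fh <= d.+1)%N.
Proof.
apply: size_graded_subst => m; apply: contraTT; rewrite -ltnNge => dm.
rewrite -mcoeff_eq0 /trunc_ps raddf_sum big1 //= => -[m' /= m'd] _.
rewrite mcoeffZ mcoeffX; case: eqP => [mm|]; last by rewrite mulr0.
by move: dm; rewrite -mm ltnNge -ltnS m'd.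
Qed.

Lemma graded_series1 : fh.[1] = f.
Proof.
rewrite -horner_evalE (@rmorph_mmap _ _ _ _ (horner_eval 1) _ (mpolyC n (R := F)) _ (fun j => 'X_j)).
- rewrite /mmap [RHS]mpolyE; apply: eq_bigr => m _.
  by rewrite mmap1_id mul_mpolyC.
- by move=> c; rewrite /= horner_evalE hornerC.
by move=> j; rewrite /= horner_evalE hornerM hornerC hornerX mulr1.
Qed.

(** Up to degree [d] in [x], [P(x, f)] agrees with [P(x, phi) = 0], and cutting [P] only changes
    multiples of [lam^(d+1)]. The constant coefficient of the same identity gives the second
    claim. *)
Lemma bivariate_root : (exists r, (bivariate P').[fh] = r * 'X^(d.+1)) /\ P'@_0%MM = 0.
Proof.
have [f' fE] := poly_coef0_divX graded_series_coef0.
(* Factoring [lam] out of [fh] turns the substitution [y := fh] into a graded one. *)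
pose w := split_subst (fun j : 'I_n => ('X_j : A)%:P) f'.
have PE (Q : {mpoly F[n.+1]}) : (bivariate Q).[fh] = graded_subst w Q.
  rewrite -horner_evalE; apply: rmorph_mmap => i /=.
    by rewrite horner_evalE hornerC.
  rewrite horner_evalE /w /split_subst; case: insub => [j|].
    by rewrite -polyCM hornerC.
  by rewrite hornerX fE.
have [r rE] : exists r, (bivariate P').[fh] = r * 'X^(d.+1).
  have [r1 r1E] := graded_subst_trunc d w P.
  pose g := mmap (mpolyC n (R := F)) (split_subst (fun i => 'X_i) f) P.
  have gE : graded_subst (fun j : 'I_n => ('X_j)%:P) g = graded_subst w P.
    apply: rmorph_mmap => i /=; first by rewrite /= mmapC.
    rewrite /w /split_subst; case: insub => [j|]; first by rewrite mmapX mmap1U.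
    by rewrite -fE.
  have [|r2 r2E] := @graded_subst_divXn F n n (fun j : 'I_n => ('X_j)%:P) g d.
    move=> m; apply: contraTT; rewrite -leqNgt => md.
    by rewrite -mcoeff_eq0 (agree_subst_last _ (@agree_trunc_ps F n d phi)) // Pphi.
  exists (r2 - r1); rewrite mulrBl -r2E gE r1E PE; ring.
split; first by exists r.
have := congr1 (fun p : {poly A} => p`_0) rE.
rewrite PE graded_subst_coef0 coefMXn => h.
by apply: (can_inj (@mpolyCK n F)); rewrite h mpolyC0.
Qed.

(** A monomial containing some [x] variable is a multiple of [lam], and a pure power of [y] beyond
    the first a multiple of [y^2]. *)
Lemma bivariate_split (Q : {mpoly F[n.+1]}) : exists a b,
  bivariate Q = poly2C Q@_0%MM + poly2C Q@_U_(ord_max) * 'X + 'X^2 * a + lam * b.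
Proof.
elim/mpolyind: Q => [|c m Q _ _ [a [b IHQ]]].
  by exists 0, 0; rewrite rmorph0 !mcoeff0 !rmorph0; ring.
suff [a' [b' mE]] : exists a b, bivariate 'X_[m] =
    poly2C (m == 0%MM)%:R + poly2C (m == U_(ord_max)%MM)%:R * 'X + 'X^2 * a + lam * b.
  exists (poly2C c * a' + a), (poly2C c * b' + b).
  have -> : bivariate (c *: 'X_[m] + Q) = poly2C c * bivariate 'X_[m] + bivariate Q.
    by rewrite rmorphD; congr (_ + _); apply: mmapZ.
  have coefE k : poly2C (c *: 'X_[m] + Q)@_k = poly2C c * poly2C (m == k)%:R + poly2C Q@_k.
    by rewrite mcoeffD mcoeffZ mcoeffX -rmorphM -rmorphD.
  rewrite !coefE IHQ mE; move: (poly2C c) (poly2C (m == 0%MM)%:R) (poly2C Q@_0%MM)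
    (poly2C (m == U_(ord_max)%MM)%:R) (poly2C Q@_U_(ord_max)%MM) => u v x y z; ring.
have -> : bivariate 'X_[m] = mmap1 (fun j => ('X_j)%:P%:P) (mnm_init m) *
    lam ^+ mdeg (mnm_init m) * 'X^(m ord_max).
  rewrite /bivariate mmapX mmap1_split; congr (_ * _).
  rewrite /mmap1 mdegE expr_sum -big_split /=.
  by apply: eq_bigr => i _; rewrite exprMn.
have m0E : (m == 0%MM) = (mdeg (mnm_init m) == 0%N) && (m ord_max == 0%N).
  by rewrite -mdeg_eq0 mdeg_split addn_eq0.
have m1E : (m == U_(ord_max)%MM) = (mdeg (mnm_init m) == 0%N) && (m ord_max == 1%N).
  apply/eqP/andP => [mU|[/eqP k0 /eqP l1]].
    have mm : m ord_max = 1%N by rewrite mU mnm1E eqxx.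
    have : mdeg m = 1%N by rewrite mU mdeg1.
    by rewrite mdeg_split mm addn1 => -[->].
  have /eqP : mdeg m = 1%N by rewrite mdeg_split k0 l1.
  move=> /mdeg1P[i /eqP mU]; move: l1; rewrite mU mnm1E.
  by case: eqP => // ->.
rewrite m0E m1E.
have c1E : mdeg (mnm_init m) = 0%N -> mmap1 (fun j : 'I_n => (('X_j : A)%:P%:P : {poly {poly A}})) (mnm_init m) = 1.
  by move=> /eqP; rewrite mdeg_eq0 => /eqP ->; apply: mmap11.
move: (mmap1 _ _) c1E => c1; move: (mdeg (mnm_init m)) (m ord_max) => [|k] l c1E /=.
  have -> : c1 * lam ^+ 0 * 'X^l = 'X^l by rewrite (c1E erefl); ring.
  case: l => [|[|l]] /=.
  - by exists 0, 0; rewrite rmorph0 rmorph1; ring.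
  - by exists 0, 0; rewrite rmorph0 rmorph1; ring.
  - by exists 'X^l, 0; rewrite rmorph0 -addn2 exprD; ring.
by exists 0, (c1 * lam ^+ k * 'X^l); rewrite rmorph0 exprS; ring.
Qed.

Lemma bideg_le_bivariate : bideg_le d (bivariate P').
Proof.
rewrite /bivariate /mmap big_seq; apply: bideg_le_sum => m /mdeg_trunc_mpoly md.
rewrite mmap1_split mulrA.
apply: (@bideg_leW _ (mdeg (mnm_init m) + m ord_max)); first by rewrite -mdeg_split.
apply: bideg_leM; last by have := @bideg_leX A 1 'X (m ord_max) (@bideg_le_var A); rewrite muln1.
rewrite -[mdeg _]add0n; apply: bideg_leM; first exact: bideg_leC.
rewrite /mmap1 mdegE; elim/big_rec2: _ => [|i x k _ IH].
  by rewrite -!polyC1; apply: bideg_leC.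
apply: bideg_leM => //; have := @bideg_leX _ 1 (('X_i)%:P%:P * lam) (mnm_init m i); rewrite muln1; apply.
by rewrite -[1%N]add0n; apply: bideg_leM; [apply: bideg_leC|exact: (@bideg_le_lam A)].
Qed.

(** What is normalized to 1 is the coefficient of [y] at [lam = 0], not a leading coefficient. *)
Definition bivariate_monic := poly2C alpha^-1 * bivariate P'.
Local Notation p := bivariate_monic.

Lemma bivariate_monicE : exists a b, 'X - p = 'X^2 * a + lam * b.
Proof.
have [a [b PE]] := bivariate_split P'.
have alphaE : P'@_U_(ord_max) = alpha.
  rewrite mcoeff_trunc_mpoly mdeg1 d0 /alpha.
  by rewrite meval_zero mcoeff_deriv add0m mnm0E mulr1n.
have [_ P0] := bivariate_root.
exists (- poly2C alpha^-1 * a), (- poly2C alpha^-1 * b).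
rewrite /p PE P0 alphaE rmorph0 add0r.
have : poly2C alpha^-1 * poly2C alpha = 1.
  by rewrite -(rmorphM poly2C) (mulVf alpha0); apply: rmorph1.
move: (poly2C _) (poly2C _) => u v uv.
by rewrite !mulrDr mulrA uv; ring.
Qed.

Lemma graded_series_formula j : (j <= d)%N ->
  ('X * p^`() * \sum_(i < (3 * d).+2)
       'X ^+ ((3 * d).+1 - i) * ('X - p) ^+ i)`_(3 * d).+1`_j = fh`_j.
Proof.
have [[r rE] _] := bivariate_root.
have [a [b pE]] := bivariate_monicE.
have pr : p.[fh] = (alpha^-1)%:MP%:P * r * 'X^(d.+1).
  by rewrite hornerM hornerC rE mulrA.
(* Dividing [p] by [y - fh] leaves the remainder [p.[fh]], a multiple of [lam^(d+1)], as
   [residue_formula] requires. *)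
have : root (p - p.[fh]%:P) fh by rewrite /root hornerD hornerN hornerC subrr.
move=> /factor_theorem[q qE]; have pq : p = q * ('X - fh%:P) + p.[fh]%:P by rewrite -qE subrK.
rewrite pr in pq.
have q0 : q`_0`_0 = 1.
  have p1 : p`_1`_0 = 1 by rewrite -[p](subKr 'X) pE; apply: coef10_monic.
  by rewrite -p1 {1}pq (coef10_mulXsub _ _ graded_series_coef0).
exact: (residue_formula d0 pq graded_series_coef0 q0 pE).
Qed.

End PowerSeriesRoot.

(** * Interpolating the root *)

Section PolynomiallyBounded.
Implicit Types f g : nat -> nat -> nat.

(** The base is at least 2, so sums and constants are absorbed by raising the exponent. *)
Definition poly_bounded f := exists k, forall d s, (f d s <= (d + s + 2) ^ k)%N.

Lemma poly_bounded_leq f g : (forall d s, (f d s <= g d s)%N) -> poly_bounded g -> poly_bounded f.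
Proof. by move=> fg [k gk]; exists k => d s; apply: leq_trans (fg d s) (gk d s). Qed.

Lemma poly_boundedD f g : poly_bounded f -> poly_bounded g -> poly_bounded (fun d s => f d s + g d s)%N.
Proof.
move=> [k fk] [l gl]; exists (maxn k l).+1 => d s.
rewrite expnS; apply: (@leq_trans (2 * (d + s + 2) ^ maxn k l)).
  rewrite mul2n -addnn; apply: leq_add.
    by apply: leq_trans (fk d s) _; apply: leq_pexp2l; rewrite ?leq_maxl ?addn2.
  by apply: leq_trans (gl d s) _; apply: leq_pexp2l; rewrite ?leq_maxr ?addn2.
by rewrite leq_mul2r leq_addl orbT.
Qed.

Lemma poly_boundedM f g : poly_bounded f -> poly_bounded g -> poly_bounded (fun d s => f d s * g d s)%N.
Proof. by move=> [k fk] [l gl]; exists (k + l)%N => d s; rewrite expnD; apply: leq_mul. Qed.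

Lemma poly_bounded_const c : poly_bounded (fun _ _ => c).
Proof.
exists c => d s; apply: leq_trans (ltnW (ltn_expl c (ltnSn 1))) _.
by case: c => // c; rewrite leq_exp2r // leq_addl.
Qed.

Lemma poly_boundedS f : poly_bounded f -> poly_bounded (fun d s => (f d s).+1).
Proof.
move=> pf; apply: poly_bounded_leq (poly_boundedD pf (poly_bounded_const 1)) => d s.
by rewrite addn1.
Qed.

Lemma poly_boundedX f k : poly_bounded f -> poly_bounded (fun d s => f d s ^ k)%N.
Proof. by move=> [l fl]; exists (l * k)%N => d s; rewrite expnM; case: k => // k; rewrite leq_exp2r. Qed.

Lemma poly_bounded_fst : poly_bounded (fun d _ => d).
Proof. by exists 1%N => d s; rewrite expn1 -addnA leq_addr. Qed.

Lemma poly_bounded_snd : poly_bounded (fun _ s => s).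
Proof. by exists 1%N => d s; rewrite expn1 addnAC leq_addl. Qed.

Lemma poly_bounded_eval2 f : poly_bounded f ->
  exists q : {mpoly int[2]}, forall d s, (f d s)%:Z <= eval2 q d s.
Proof.
move=> [k fk]; exists (('X_0 + 'X_1 + 2%:R) ^+ k) => d s.
rewrite /eval2 rmorphXn !rmorphD /= !mevalXU meval1 /=.
have := fk d s; rewrite -lez_nat => h; apply: Order.POrderTheory.le_trans h _.
by rewrite -natrXE rmorphXn /= !PoszD.
Qed.

End PolynomiallyBounded.

(** * The root as a combination of values of [P] on a grid *)

Section RootInterpolation.
Variables (F : fieldType) (n d : nat) (d0 : (0 < d)%N).
Local Notation A := {mpoly F[n]}.
Variables (P : {mpoly F[n.+1]}) (phi : pseries F n).
Hypotheses (phi0 : phi 0%MM = 0) (Pphi : ps_subst_last P phi = fun=> 0).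
Let alpha := (P^`M(ord_max)).@[fun=> 0].
Hypothesis alpha0 : alpha != 0.
Local Notation P' := (trunc_mpoly d P).
Local Notation f := (trunc_ps d phi).
Local Notation p := (bivariate_monic d P).

Definition eval_point (t e : F) (G : {poly {poly A}}) : A := G.[e%:MP%:P].[t%:MP].

Definition scaled_subst (t e : F) : 'I_n.+1 -> A := split_subst (fun j => t *: 'X_j) e%:MP.

Definition value_at (t e : F) : A := alpha^-1 *: mmap (mpolyC n (R := F)) (scaled_subst t e) P'.

Lemma eval_point_monic t e : eval_point t e p = value_at t e.
Proof.
rewrite /eval_point /bivariate_monic hornerM hornerC hornerM hornerC mul_mpolyC; congr (_ *: _).
rewrite -(horner_evalE e%:MP%:P) -(horner_evalE t%:MP).
rewrite (@rmorph_mmap _ _ _ _ (horner_eval (e%:MP%:P : {poly A})) _ (polyC \o mpolyC n (R := F))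
  _ (split_subst (fun j => ('X_j)%:P * 'X) e%:MP%:P)).
- apply: rmorph_mmap => i /=; first by rewrite horner_evalE hornerC.
  rewrite horner_evalE /scaled_subst /split_subst; case: insub => [j|].
    by rewrite hornerM hornerC hornerX mulrC mul_mpolyC.
  by rewrite hornerC.
- by move=> c; rewrite /= horner_evalE hornerC.
move=> i; rewrite /= horner_evalE /split_subst; case: insub => [j|].
  by rewrite hornerM !hornerC.
by rewrite hornerX.
Qed.

Lemma bideg_le_monic : bideg_le d p.
Proof.
rewrite -[d in bideg_le d]add0n; apply: bideg_leM; first exact: bideg_leC.
exact: bideg_le_bivariate.
Qed.

(** One more than the degree bound for the residue expression: [1 + d] from [y p'] and [N + N d]
    from the geometric sum, with [N = 3d + 1]. The same nodes serve both variables. *)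
Definition grid_size : nat := (2 + d + ((3 * d).+1 + (3 * d).+1 * d))%N.

Variable L : seq F.
Hypotheses (uniqL : uniq L) (sizeL : size L = grid_size).

Definition deriv_value t e : A := \sum_(u <- L) (lagrange_basis L u)^`().[e] *: value_at t u.

Lemma eval_point_deriv t e : eval_point t e p^`() = deriv_value t e.
Proof.
have sp : (size p <= size L)%N.
  apply: leq_trans (bideg_le_size bideg_le_monic) _; rewrite sizeL /grid_size; lia.
rewrite /eval_point (deriv_interpolation (polyC \o mpolyC n (R := F)) e uniqL sp).
rewrite horner_sum; apply: eq_bigr => u _.
by rewrite hornerM hornerC mul_mpolyC -eval_point_monic.
Qed.

Definition root_term t e i : A := deriv_value t e * (e%:MP - value_at t e) ^+ i.

Lemma trunc_root_formula : f = \sum_(t <- L) (\sum_(j < d.+1) (lagrange_basis L t)`_j) *: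
  \sum_(e <- L) (lagrange_basis L e)`_(3 * d).+1 *:
    \sum_(i < (3 * d).+2) (e * e ^+ ((3 * d).+1 - i)) *: root_term t e i.
Proof.
pose G := 'X * p^`() * \sum_(i < (3 * d).+2) 'X ^+ ((3 * d).+1 - i) * ('X - p) ^+ i.
pose iota1 : {rmorphism F -> A} := mpolyC n (R := F).
pose iota2 : {rmorphism F -> {poly A}} := polyC \o mpolyC n (R := F).
have bG : bideg_le grid_size.-1 G.
  apply: (@bideg_leW _ ((1 + d) + ((3 * d).+1 + (3 * d).+1 * d))); first by [].
  apply: bideg_leM; first by apply: bideg_leM; [exact: bideg_le_var|exact/bideg_le_deriv/bideg_le_monic].
  apply: bideg_le_sum => i _; apply: bideg_leM.
    apply: (@bideg_leW _ (((3 * d).+1 - i) * 1)); first by rewrite muln1 leq_subr.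
    exact/bideg_leX/bideg_le_var.
  apply: (@bideg_leW _ (i * d)); first by rewrite leq_mul2r -ltnS ltn_ord orbT.
  apply/bideg_leX/bideg_leD; last exact/bideg_leN/bideg_le_monic.
  by apply: bideg_leW (@bideg_le_var A).
have evG t e : eval_point t e G = 
    \sum_(i < (3 * d).+2) (e * e ^+ ((3 * d).+1 - i)) *: root_term t e i.
  rewrite /eval_point /G !hornerM hornerX hornerC -/(eval_point t e _) eval_point_deriv.
  rewrite !horner_sum mulr_sumr; apply: eq_bigr => i _.
  rewrite !hornerM !horner_exp hornerX hornerC hornerD hornerN hornerX hornerD hornerN hornerC.
  rewrite -/(eval_point t e _) eval_point_monic /root_term -mul_mpolyC rmorphM rmorphXn /=.
  move: (deriv_value t e) ((_ - _) ^+ _) => u v; ring.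
have coefG j : (j <= d)%N -> (graded_series d phi)`_j =
    \sum_(t <- L) (lagrange_basis L t)`_j *: \sum_(e <- L) (lagrange_basis L e)`_(3 * d).+1 *: eval_point t e G.
  move=> jd; rewrite -(graded_series_formula d0 phi0 Pphi alpha0 jd) -/G.
  rewrite (interpolation iota1 j uniqL) ?sizeL; last exact: bideg_le_size2 bG.
  apply: eq_bigr => t _; rewrite mul_mpolyC; congr (_ *: _).
  rewrite (interpolation iota2 _ uniqL) ?sizeL; last exact: bideg_le_size bG.
  by rewrite horner_sum; apply: eq_bigr => e _; rewrite hornerM hornerC mul_mpolyC.
(* At [lam = 1] the graded series is [f], so its coefficients are simply added up. *)
rewrite -[LHS]graded_series1 (horner_coef_wide _ (size_graded_series d phi)).
rewrite (eq_bigr (fun j : 'I_d.+1 => \sum_(t <- L) (lagrange_basis L t)`_j *: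
    \sum_(e <- L) (lagrange_basis L e)`_(3 * d).+1 *: eval_point t e G)); last first.
  by move=> j _; rewrite expr1n mulr1 coefG // -ltnS.
rewrite exchange_big /=; apply: eq_bigr => t _.
rewrite scaler_suml; apply: eq_bigr => j _; congr (_ *: _).
by apply: eq_bigr => e _; rewrite evG.
Qed.

(** From outside in: the sums over [t], [e] and [i], the product in [root_term], and its factors;
    [grid_size + 2] covers both the derivative and the two-term difference. *)
Definition root_cost (Q : nat) : nat :=
  (grid_size * (grid_size * ((3 * d).+2 * ((3 * d).+2 * ((grid_size + 2) * Q.+1).+1).+1).+1).+1)%N.

(** Five layers: derivatives and differences in parallel, the product of a term, then the sums over
    [i], [e] and [t]. *)
Lemma trunc_root_obtainable C D Q :
  (forall t e, obtainable C (mmap (mpolyC n (R := F)) (scaled_subst t e) P') D Q) ->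
  obtainable C f (D + 5) (root_cost Q).
Proof.
move=> obP; rewrite trunc_root_formula (addnC D) -[(5 + D)%N]/(D.+2.+3).
have obV t e : obtainable C (value_at t e) D Q by apply: obtainableZ.
have obD t e : obtainable C (deriv_value t e) D.+1 ((grid_size + 2) * Q.+1).
  apply: (obtainableW (leqnn _)); last by apply: obtainable_sum => u _; apply: obtainableZ.
  by rewrite sizeL leq_mul2r leq_addr orbT.
have obB t e : obtainable C (e%:MP - value_at t e) D.+1 ((grid_size + 2) * Q.+1).
  rewrite -[_ - _](_ : \sum_(q <- [:: e%:MP; - value_at t e]) q = _); last by rewrite big_cons big_seq1.
  apply: (@obtainableW _ _ _ _ D.+1 _ (2 * Q.+1)) => //; first by rewrite leq_mul2r leq_addl orbT.
  apply: obtainable_sum => q; rewrite !inE => /orP[] /eqP ->.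
    exact: (obtainableW (leqnn _) (leq0n _) (@obtainable_const _ _ C e D)).
  by rewrite -scaleN1r; apply: obtainableZ.
have obT t e (i : 'I_(3 * d).+2) :
    obtainable C (root_term t e i) D.+2 ((3 * d).+2 * ((grid_size + 2) * Q.+1).+1).
  rewrite /root_term.
  have -> : deriv_value t e * (e%:MP - value_at t e) ^+ i =
      \prod_(q <- deriv_value t e :: nseq i (e%:MP - value_at t e)) q.
    by rewrite big_cons big_nseq -Monoid.iteropE.
  apply: (@obtainableW _ _ _ _ D.+2 _ (i.+1 * ((grid_size + 2) * Q.+1).+1)) => //.
    by rewrite leq_mul2r ltn_ord orbT.
  rewrite -[i.+1](_ : size (deriv_value t e :: nseq i (e%:MP - value_at t e)) = _); last first.
    by rewrite /= size_nseq.
  by apply: obtainable_prod => q; rewrite inE => /orP[/eqP ->|/nseqP[-> _]].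
rewrite /root_cost -sizeL; apply: obtainable_sum => t _; apply: obtainableZ.
apply: obtainable_sum => e _; apply: obtainableZ; rewrite sizeL.
apply: (obtainableW (leqnn _)); last first.
  by apply: obtainable_sum => i _; apply: obtainableZ; apply: obT.
by rewrite size_index_enum card_ord.
Qed.

End RootInterpolation.

(** The outer successor counts the wire of the output gate. *)
Lemma poly_bounded_root_cost : poly_bounded (fun d s => (root_cost d (trunc_cost s d)).+1).
Proof.
rewrite /root_cost /trunc_cost /step_cost /grid_size /fiber_degree.
repeat lazymatch goal with
| |- poly_bounded (fun d s => (@?f d s + @?g d s)%N) => apply: (@poly_boundedD f g)
| |- poly_bounded (fun d s => (@?f d s * @?g d s)%N) => apply: (@poly_boundedM f g)
| |- poly_bounded (fun d s => (@?f d s ^ ?k)%N) => apply: (@poly_boundedX f k)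
| |- poly_bounded (fun d s => d) => exact: poly_bounded_fst
| |- poly_bounded (fun d s => s) => exact: poly_bounded_snd
| |- poly_bounded (fun d s => (@?f d s).+1) => apply: (@poly_boundedS f)
| |- _ => exact: poly_bounded_const
end.
Qed.

Lemma scaled_subst_obtainable (F : fieldType) n (C : circuit F n) t e i D :
  obtainable C (scaled_subst t e i) D 0.
Proof.
rewrite /scaled_subst /split_subst; case: insub => [j|]; last exact: obtainable_const.
exact/obtainableZ/obtainable_var.
Qed.

Lemma trunc_ps0 (F : fieldType) n (phi : pseries F n) : phi 0%MM = 0 -> trunc_ps 0 phi = 0.
Proof.
move=> phi0; rewrite /trunc_ps big1 // => -[m /=]; rewrite ltnS leqn0 mdeg_eq0 => /eqP -> _.
by rewrite phi0 scale0r.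
Qed.

Theorem theorem4p1 (F : fieldType) (F_infinite : forall s : seq F, exists x : F, x \notin s) :
  exists (q : {mpoly int[2]}) (c : nat),
  forall (n : nat) (P : {mpoly F[n.+1]}) (C : circuit F n.+1) (phi : pseries F n),
    computes C P ->
    phi 0%MM = 0 ->
    ps_subst_last P phi = (fun _ => 0) ->
    (P^`M(ord_max)).@[fun _ => 0] != 0 ->
    forall d : nat, exists C' : circuit F n,
      computes C' (trunc_ps d phi) /\
      (circuit_size C')%:Z <= eval2 q d (circuit_size C) /\
      (circuit_depth C' <= circuit_depth C + c)%N.
Proof.
have [q qP] := poly_bounded_eval2 poly_bounded_root_cost.
(* The 7 layers are one for truncating [P], five for the residue expression and one for the output
   gate. *)
exists q, 7%N => n P C phi [[C_gt0 wfC] CP] phi0 Pphi alpha0 [|d].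
  (* For [d = 0] the truncation is [phi 0 = 0]; the residue formula needs [d > 0]. *)
  exists [:: GConst n 0]; rewrite trunc_ps0 //; split; [|split] => //.
    split; last by rewrite /circuit_output /= mpolyC0.
    by split=> // -[].
  apply: Order.POrderTheory.le_trans (qP _ _).
  by rewrite /circuit_size big_seq1.
set s := circuit_size C.
have [L uniqL sizeL] := infinite_uniq_seq F_infinite (fiber_degree s d.+1).+1.
have [L2 uniqL2 sizeL2] := infinite_uniq_seq F_infinite (grid_size d.+1).
have obP t e : obtainable [::] (mmap (mpolyC n (R := F)) (scaled_subst t e) (trunc_mpoly d.+1 P))
    (circuit_depth C).+1 (trunc_cost s d.+1).
  rewrite -CP; apply: (trunc_obtainable wfC _ _ uniqL sizeL) => // C' i D.
  exact: scaled_subst_obtainable.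
have := trunc_root_obtainable (ltn0Sn d) phi0 Pphi alpha0 uniqL2 sizeL2 obP.
move=> /obtainable_computes[C' [C'f sz dep]]; exists C'; split=> //; split.
  apply: Order.POrderTheory.le_trans (qP _ _); by rewrite lez_nat.
by apply: leq_trans dep _; rewrite addSn -addnS addnC addnS addnC -addnS.
Qed.
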